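(* For any convex body $\Omega\subseteq \mathbb{R}^n$ ($n\ge 2$), $$|\partial\Omega|\leq \frac{(2n)^n}{\omega_{n-1}}A_{n-1}(\Omega).$$ In particular, the following statement (T) implies the following statement (C). (T) For each $n\geq 2$, there exist constants $C_1,C_2>0$ depending only on $n$ such that for any bounded convex domain $\Omega\subseteq\mathbb{R}^n$, $$C_1\cdot\frac{|\partial\Omega|^n}{|\Omega|^{n-1}}\leq N(\Omega)\leq C_2\cdot \frac{|\partial\Omega|^n}{|\Omega|^{n-1}};$$ moreover, it suffices to take $C_1=\omega_n\cdot 184^{-n}\cdot n^{-\frac{3}{2}n(n+1)}$ and $C_2=92^n\cdot n^{\frac{3}{2}n^2+n}$. (C) Let $n\geq 2$, and let $C_1$ and $C_2$ be as in (T). Then for any bounded convex domain $\Omega\subseteq\mathbb{R}^n$, $$2^n\cdot C_1\cdot \frac{A_{n-1}(\Omega)^n}{|\Omega|^{n-1}}\leq N(\Omega)\leq \frac{(2n)^{n^2}}{\omega_{n-1}^{n}}\cdot C_2\cdot\frac{A_{n-1}(\Omega)^n}{|\Omega|^{n-1}}.$$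
   Context: Here a convex body is a bounded convex set with nonempty interior. $|\Omega|$ is the $n$-dimensional Hausdorff measure of $\Omega$ and $|\partial\Omega|$ is the $(n-1)$-dimensional Hausdorff measure of its boundary. $\omega_k$ is the volume of the unit ball in $\mathbb{R}^k$. $A_{n-1}(\Omega):=\sup_{V}|\Omega\cap V|$, where $V$ ranges over all $(n-1)$-dimensional affine subspaces of $\mathbb{R}^n$ and $|\Omega\cap V|$ is $(n-1)$-dimensional measure. For a bounded Lipschitz domain $\Omega$, let $0=\mu_1<\mu_2\leq\mu_3\leq\dots$ (resp. $0<\lambda_1<\lambda_2\leq\dots$) be the eigenvalues, counted with multiplicity, of the (positive) Laplacian on $\Omega$ with Neumann (resp. Dirichlet) boundary conditions, and $N(\Omega):=\#\{j\mid\mu_j\leq\lambda_1\}$. *)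

(* Defs.v *)
From HB Require Import structures.
From mathcomp Require Import all_boot all_order all_algebra.
From mathcomp Require Import all_classical all_reals all_analysis.

Set Implicit Arguments.
Unset Strict Implicit.
Unset Printing Implicit Defensive.
Import Order.TTheory GRing.Theory Num.Theory.
Import numFieldNormedType.Exports.
Local Open Scope classical_set_scope.
Local Open Scope ring_scope.

(* R^n is ['rV[R]_n]. The library puts the sup norm on it, which gives the
   right topology and the right bounded sets; the Euclidean norm, needed for
   diameters and balls, is defined here. *)
Definition enorm (R : realType) (n : nat) (x : 'rV[R]_n) : R :=
  Num.sqrt (\sum_(i < n) x ord0 i ^+ 2).

(** * Outer measures from coverings *)

Definition cover_outer (R : realType) (T : Type) (g : set T -> \bar R)
    (A : set T) : \bar R :=
  ereal_inf [set (\sum_(k <oo) g (F k))%E |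
             F in [set F : (set T)^nat | A `<=` \bigcup_k F k]].

(* [cover_outer] is the library's [mu_ext] for the sigma-algebra of all sets. *)
Lemma cover_outerE (R : realType) (T : pointedType) (g : set T -> \bar R) :
  cover_outer g = mu_ext (g : set (g_sigma_algebraType [set: set T]) -> \bar R).
Proof.
apply/funext => A; rewrite /cover_outer /mu_ext; congr (ereal_inf (image _ _)).
apply/seteqP; split => F /= => [AF|[]//].
by split => // i; apply: sub_sigma_algebra.
Qed.

(** * Lebesgue measure on R^n *)

(* The value is [+oo] unless [B] is empty or a closed box. *)
Definition box_volume (R : realType) (n : nat) (B : set 'rV[R]_n) : \bar R :=
  ereal_inf [set v : \bar R | (B = set0 /\ v = 0%E) \/
    exists a b : 'rV[R]_n,
      [/\ forall i, a ord0 i <= b ord0 i,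
          B = [set x | forall i, a ord0 i <= x ord0 i <= b ord0 i] &
          v = (\prod_(i < n) (b ord0 i - a ord0 i))%:E]].

Definition lebesgue (R : realType) (n : nat) : set 'rV[R]_n -> \bar R :=
  cover_outer (@box_volume R n).

Lemma box_volume_ge0 (R : realType) n (B : set 'rV[R]_n) :
  (0 <= box_volume B)%E.
Proof.
apply: le_ereal_inf_tmp => v /= [[_ ->//]|[a [b [ab _ ->]]]].
by rewrite lee_fin prodr_ge0// => i _; rewrite subr_ge0.
Qed.

Lemma box_volume0 (R : realType) n : box_volume (set0 : set 'rV[R]_n) = 0%E.
Proof.
apply/eqP; rewrite eq_le box_volume_ge0 andbT.
by apply: ereal_inf_lbound; left.
Qed.

Section lebesgue_outer_measure.
Variables (R : realType) (n : nat).

Let lebesgueE : @lebesgue R n = mu_ext (@box_volume R n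
  : set (g_sigma_algebraType [set: set 'rV[R]_n]) -> \bar R).
Proof. exact: cover_outerE. Qed.

Let lebesgue0 : @lebesgue R n set0 = 0%E.
Proof.
rewrite lebesgueE mu_ext0//; first exact: box_volume0.
by move=> ?; exact: box_volume_ge0.
Qed.

Let lebesgue_ge0 A : (0 <= @lebesgue R n A)%E.
Proof. by rewrite lebesgueE; apply: mu_ext_ge0 => ?; exact: box_volume_ge0. Qed.

Let le_lebesgue : {homo @lebesgue R n : A B / A `<=` B >-> (A <= B)%E}.
Proof.
move=> A B AB; apply/ereal_inf_le_tmp => x [F BF <-{x}].
by exists F => //; exact: subset_trans AB BF.
Qed.

Let lebesgue_sigma_subadditive : sigma_subadditive (@lebesgue R n).
Proof.
rewrite lebesgueE => F.
apply: (@mu_ext_sigma_subadditive _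
  (g_sigma_algebraType [set: set 'rV[R]_n])) => ?.
exact: box_volume_ge0.
Qed.

HB.instance Definition _ := isOuterMeasure.Build R _ (@lebesgue R n)
  lebesgue0 lebesgue_ge0 le_lebesgue lebesgue_sigma_subadditive.

End lebesgue_outer_measure.

(* R^n with its Lebesgue measurable sets, and [lebesgue] as a measure. *)
Notation lebType R n := (caratheodory_type (@lebesgue R n)).

Definition leb (R : realType) (n : nat) :
    {measure set (lebType R n) -> \bar R} :=
  (@lebesgue R n : {outer_measure set 'rV[R]_n -> \bar R}).

Definition ball_volume (R : realType) (k : nat) : R :=
  fine (lebesgue [set x : 'rV[R]_k | enorm x <= 1]).

(** * Hausdorff measure *)

Definition diameter (R : realType) (n : nat) (A : set 'rV[R]_n) : \bar R :=
  ereal_sup [set (enorm (x - y))%:E | x in A & y in A].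

Definition hausdorff_gauge (R : realType) (n d : nat) (delta : R)
    (A : set 'rV[R]_n) : \bar R :=
  if A == set0 then 0%E
  else if (diameter A <= delta%:E)%E
  then ((ball_volume R d / 2 ^+ d)%:E * diameter A ^+ d)%E
  else +oo%E.

(* Normalized so that the n-dimensional measure on R^n is Lebesgue measure. *)
Definition hausdorff (R : realType) (n d : nat) (A : set 'rV[R]_n) : \bar R :=
  ereal_sup [set cover_outer (hausdorff_gauge d delta) A |
             delta in [set delta : R | 0 < delta]].

(** * Convex sets *)

Definition boundary (T : topologicalType) (A : set T) : set T :=
  closure A `\` interior A.

Definition convex_body (R : realType) (n : nat) (Omega : set 'rV[R]_n) : Prop :=
  [/\ bounded_set Omega,
      convex_set (Omega : set (convex_lmodType 'rV[R]_n)) &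
      interior Omega !=set0].

(* Connectedness of the domain follows from convexity. *)
Definition bounded_convex_domain (R : realType) (n : nat)
    (Omega : set 'rV[R]_n) : Prop :=
  [/\ open Omega, Omega !=set0, bounded_set Omega &
      convex_set (Omega : set (convex_lmodType 'rV[R]_n))].

Definition affine_subspace (R : realType) (n d : nat)
    (V : set 'rV[R]_n) : Prop :=
  exists (p : 'rV[R]_n) (W : 'M[R]_n),
    \rank W = d /\ V = [set x | (x - p <= W)%MS].

Definition max_section (R : realType) (n : nat) (Omega : set 'rV[R]_n)
    : \bar R :=
  ereal_sup [set hausdorff n.-1 (Omega `&` V) |
             V in [set V : set 'rV[R]_n | affine_subspace n.-1 V]].

(** * Sobolev spaces *)

Definition partial (R : realType) (n : nat) (i : 'I_n)
    (f : 'rV[R]_n -> R^o) : 'rV[R]_n -> R^o :=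
  fun x => 'D_(delta_mx ord0 i) f x.

Definition iter_partial (R : realType) (n : nat) (s : seq 'I_n)
    (f : 'rV[R]_n -> R^o) : 'rV[R]_n -> R^o :=
  foldr (@partial R n) f s.

Definition smooth (R : realType) (n : nat) (f : 'rV[R]_n -> R^o) : Prop :=
  forall s : seq 'I_n, continuous (iter_partial s f) /\
    forall (i : 'I_n) x, derivable (iter_partial s f) x (delta_mx ord0 i).

Definition test_function (R : realType) (n : nat) (Omega : set 'rV[R]_n)
    (phi : 'rV[R]_n -> R) : Prop :=
  smooth phi /\ exists K : set 'rV[R]_n,
    [/\ compact K, K `<=` Omega & forall x, ~ K x -> phi x = 0].

Definition L2 (R : realType) (n : nat) (Omega : set 'rV[R]_n)
    (u : 'rV[R]_n -> R) : Prop :=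
  measurable_fun (Omega : set (lebType R n)) (u : lebType R n -> R) /\
  (\int[leb R n]_(x in Omega) (u x ^+ 2)%:E < +oo)%E.

Definition L2_inner (R : realType) (n : nat) (Omega : set 'rV[R]_n)
    (u v : 'rV[R]_n -> R) : R :=
  \int[leb R n]_(x in Omega) (u x * v x).

Definition weak_partial (R : realType) (n : nat) (Omega : set 'rV[R]_n)
    (i : 'I_n) (u g : 'rV[R]_n -> R) : Prop :=
  forall phi, test_function Omega phi ->
    L2_inner Omega u (partial i phi) = - L2_inner Omega g phi.

Definition H1 (R : realType) (n : nat) (Omega : set 'rV[R]_n)
    (u : 'rV[R]_n -> R) (Du : 'I_n -> 'rV[R]_n -> R) : Prop :=
  L2 Omega u /\ forall i, L2 Omega (Du i) /\ weak_partial Omega i u (Du i).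

(* The closure of the test functions in H1. *)
Definition H10 (R : realType) (n : nat) (Omega : set 'rV[R]_n)
    (u : 'rV[R]_n -> R) (Du : 'I_n -> 'rV[R]_n -> R) : Prop :=
  H1 Omega u Du /\ exists phi : nat -> 'rV[R]_n -> R,
    [/\ forall k, test_function Omega (phi k),
        (\int[leb R n]_(x in Omega) ((phi k x - u x) ^+ 2)%:E)%E
          @[k --> \oo] --> 0%E &
        forall i,
        (\int[leb R n]_(x in Omega) ((partial i (phi k) x - Du i x) ^+ 2)%:E)%E
          @[k --> \oo] --> 0%E].

(** * Laplace eigenvalues *)

(* [u] belongs to the form domain [H] and is a weak solution of
   [- Laplacian u = t u]: the boundary condition, Neumann for [H1] and
   Dirichlet for [H10], is carried by [H]. *)
Definition eigenspace_of (R : realType) (n : nat)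
    (H : set 'rV[R]_n -> ('rV[R]_n -> R) -> ('I_n -> 'rV[R]_n -> R) -> Prop)
    (Omega : set 'rV[R]_n) (t : R) : set ('rV[R]_n -> R) :=
  [set u | exists Du, H Omega u Du /\ forall v Dv, H Omega v Dv ->
     \sum_(i < n) L2_inner Omega (Du i) (Dv i) = t * L2_inner Omega u v].

(* The dimension of a space of functions, modulo equality a.e. in [Omega]. *)
Definition ae_dim (R : realType) (n : nat) (Omega : set 'rV[R]_n)
    (E : set ('rV[R]_n -> R)) : \bar R :=
  ereal_sup [set x : \bar R | exists (k : nat) (u : 'I_k -> 'rV[R]_n -> R),
    [/\ forall j, E (u j),
        forall c : 'I_k -> R,
          {ae leb R n, forall x, Omega x -> \sum_(j < k) c j * u j x = 0} ->
          forall j, c j = 0 &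
        x = k%:R%:E]].

(* [mu] lists the eigenvalues in nondecreasing order, each one repeated
   according to its multiplicity. *)
Definition enumerates_spectrum (R : realType) (n : nat) (Omega : set 'rV[R]_n)
    (E : R -> set ('rV[R]_n -> R)) (mu : nat -> R) : Prop :=
  {homo mu : i j / (i <= j)%N >-> i <= j} /\
  forall t, counting [set j | mu j = t] = ae_dim Omega (E t).

(* Indices are shifted: the mu_1, mu_2, ... of the usual notation are the
   values at 0, 1, ... An enumeration is unique, and exists if [Omega] is a
   bounded Lipschitz domain. *)
Definition neumann_eigenvalue (R : realType) (n : nat) (Omega : set 'rV[R]_n)
    : nat -> R :=
  get (enumerates_spectrum Omega (eigenspace_of (@H1 R n) Omega)).

Definition dirichlet_eigenvalue (R : realType) (n : nat)
    (Omega : set 'rV[R]_n) : nat -> R :=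
  get (enumerates_spectrum Omega (eigenspace_of (@H10 R n) Omega)).

Definition neumann_count (R : realType) (n : nat) (Omega : set 'rV[R]_n)
    : \bar R :=
  counting [set j | neumann_eigenvalue Omega j <= dirichlet_eigenvalue Omega 0].

(** * The two estimates of [neumann_count] *)

Definition perimeter_bounds (R : realType) (n : nat) (C1 C2 : R) : Prop :=
  forall Omega : set 'rV[R]_n, bounded_convex_domain Omega ->
    (C1%:E * (hausdorff n.-1 (boundary Omega) ^+ n / hausdorff n Omega ^+ n.-1)
       <= neumann_count Omega
       <= C2%:E *
          (hausdorff n.-1 (boundary Omega) ^+ n / hausdorff n Omega ^+ n.-1))%E.

Definition section_bounds (R : realType) (n : nat) (C1 C2 : R) : Prop :=
  forall Omega : set 'rV[R]_n, bounded_convex_domain Omega ->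
    ((2 ^+ n * C1)%:E * (max_section Omega ^+ n / hausdorff n Omega ^+ n.-1)
       <= neumann_count Omega
       <= ((2 * n)%:R ^+ (n ^ 2) / ball_volume R n.-1 ^+ n * C2)%:E *
          (max_section Omega ^+ n / hausdorff n Omega ^+ n.-1))%E.

Definition explicit_C1 (R : realType) (n : nat) : R :=
  ball_volume R n * 184 ^- n * n%:R `^ (- (3 / 2 * n%:R * (n%:R + 1))).

Definition explicit_C2 (R : realType) (n : nat) : R :=
  92 ^+ n * n%:R `^ (3 / 2 * n%:R ^+ 2 + n%:R).

Definition statement_T (R : realType) : Prop :=
  forall n : nat, (2 <= n)%N ->
    (exists C1 C2 : R, [/\ 0 < C1, 0 < C2 & perimeter_bounds n C1 C2]) /\
    perimeter_bounds n (explicit_C1 R n) (explicit_C2 R n).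

(* [C1] and [C2] are any constants with the property asserted by
   [statement_T], and in particular the explicit ones given there. *)
Definition statement_C (R : realType) : Prop :=
  forall n : nat, (2 <= n)%N ->
    (forall C1 C2 : R, 0 < C1 -> 0 < C2 -> perimeter_bounds n C1 C2 ->
       section_bounds n C1 C2) /\
    section_bounds n (explicit_C1 R n) (explicit_C2 R n).

(* Main.v *)
Require Import Defs.
From HB Require Import structures.
From mathcomp Require Import all_boot all_order all_algebra.
From mathcomp Require Import all_classical all_reals all_analysis.
From mathcomp Require Import ring lra zify.

Set Implicit Arguments.
Unset Strict Implicit.
Unset Printing Implicit Defensive.
Import Order.TTheory GRing.Theory Num.Theory.
Import numFieldNormedType.Exports.
Local Open Scope classical_set_scope.
Local Open Scope ring_scope.

(* The perimeter is bounded without John's theorem. Choose orthonormal [e_i] greedily: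
   [p_i, q_i] in the closure [K] of Omega maximize the distance [d_i] between the projections
   orthogonal to the previous vectors, and [e_i] is the direction attained. Then [K] lies in a
   box with sides [d_1 >= ... >= d_n], and following outer normals from the boundary of Omega
   to the boundary of the box does not decrease distances, so the boundary of Omega has at most
   [2 n] times the measure of the box with sides [d_1, ..., d_(n-1)]. On the other hand, for
   [c] interior to Omega, the points [(c + x_1 + ... + x_(n-1)) / n] with [x_i] in the segment
   [p_i, q_i] form a parallelepiped inside a hyperplane section of Omega. In the frame [e_i] its
   edges are triangular with diagonal [d_i / n], so its translates by the lattice of the
   [d_i / n] cover the hyperplane, and its measure is at least that of the box with sides
   [d_i / n]. Since [ball_volume R (n - 1) <= 2 ^ (n - 1)], the factor [2 n ^ n] suffices. Only
   homogeneity, translation invariance and subadditivity of the Hausdorff measure are used, not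
   its comparison with Lebesgue measure.

   For the other estimate, [2 A_(n-1)(Omega) <= |boundary|], push a section to the boundary
   along both of its normals. *)

(** * Euclidean geometry *)

Section dot.
Variable R : realType.

Definition dot n (x y : 'rV[R]_n) : R := \sum_(i < n) x ord0 i * y ord0 i.

Lemma dotE n (x y : 'rV[R]_n) : dot x y = (x *m y^T) ord0 ord0.
Proof. by rewrite mxE; apply: eq_bigr => i _; rewrite mxE. Qed.

Lemma dotC n (x y : 'rV[R]_n) : dot x y = dot y x.
Proof. by apply: eq_bigr => i _; rewrite mulrC. Qed.

Lemma dotDl n (x y z : 'rV[R]_n) : dot (x + y) z = dot x z + dot y z.
Proof. by rewrite !dotE mulmxDl mxE. Qed.

Lemma dotNl n (x z : 'rV[R]_n) : dot (- x) z = - dot x z.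
Proof. by rewrite !dotE mulNmx mxE. Qed.

Lemma dotZl n a (x z : 'rV[R]_n) : dot (a *: x) z = a * dot x z.
Proof. by rewrite !dotE -scalemxAl mxE. Qed.

Lemma dot0l n (z : 'rV[R]_n) : dot 0 z = 0.
Proof. by rewrite dotE mul0mx mxE. Qed.

Lemma dotDr n (x y z : 'rV[R]_n) : dot x (y + z) = dot x y + dot x z.
Proof. by rewrite ![dot x _]dotC dotDl. Qed.

Lemma dotNr n (x z : 'rV[R]_n) : dot x (- z) = - dot x z.
Proof. by rewrite ![dot x _]dotC dotNl. Qed.

Lemma dotZr n a (x z : 'rV[R]_n) : dot x (a *: z) = a * dot x z.
Proof. by rewrite ![dot x _]dotC dotZl. Qed.

Lemma dot_suml n I (r : seq I) (P : pred I) (F : I -> 'rV[R]_n) z :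
  dot (\sum_(i <- r | P i) F i) z = \sum_(i <- r | P i) dot (F i) z.
Proof.
by apply: (big_morph (fun x => dot x z)) => [x y|]; rewrite ?dotDl ?dot0l.
Qed.

Definition dot_lin := (dotDl, dotDr, dotNl, dotNr, dotZl, dotZr).

Lemma dot_ge0 n (x : 'rV[R]_n) : 0 <= dot x x.
Proof. by apply: sumr_ge0 => i _; rewrite -expr2 sqr_ge0. Qed.

Lemma dot_gt0 n (x : 'rV[R]_n) : x != 0 -> 0 < dot x x.
Proof.
move=> x0; rewrite lt_neqAle dot_ge0 andbT eq_sym; apply: contra x0 => /eqP.
move/psumr_eq0P => h; apply/eqP/rowP => i; rewrite mxE.
by apply/eqP; rewrite -sqrf_eq0 expr2 h// => j _; rewrite -expr2 sqr_ge0.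
Qed.

Lemma dot_mulmx m n (U : 'M[R]_(m, n)) (x y : 'rV[R]_m) :
  U *m U^T = 1%:M -> dot (x *m U) (y *m U) = dot x y.
Proof.
by move=> UU; rewrite !dotE trmx_mul mulmxA -(mulmxA x) UU mulmx1.
Qed.

Lemma enormE n (x : 'rV[R]_n) : enorm x = Num.sqrt (dot x x).
Proof. by congr Num.sqrt; apply: eq_bigr => i _; rewrite expr2. Qed.

Lemma enorm_ge0 n (x : 'rV[R]_n) : 0 <= enorm x.
Proof. exact: sqrtr_ge0. Qed.

Lemma sqr_enorm n (x : 'rV[R]_n) : enorm x ^+ 2 = dot x x.
Proof. by rewrite enormE sqr_sqrtr// dot_ge0. Qed.

Lemma enorm0 n : enorm (0 : 'rV[R]_n) = 0.
Proof. by rewrite enormE dot0l sqrtr0. Qed.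

Lemma enorm_gt0 n (x : 'rV[R]_n) : x != 0 -> 0 < enorm x.
Proof. by move=> x0; rewrite enormE sqrtr_gt0 dot_gt0. Qed.

Lemma ler_enorm m n (x : 'rV[R]_m) (y : 'rV[R]_n) :
  dot x x <= dot y y -> enorm x <= enorm y.
Proof. by move=> xy; rewrite !enormE ler_wsqrtr. Qed.

Lemma enormZ n a (x : 'rV[R]_n) : enorm (a *: x) = `|a| * enorm x.
Proof.
by rewrite !enormE dotZl dotZr mulrA -expr2 sqrtrM ?sqr_ge0// sqrtr_sqr.
Qed.

Lemma ler_coord_enorm n (x : 'rV[R]_n) i : `|x ord0 i| <= enorm x.
Proof.
rewrite -sqrtr_sqr enormE ler_wsqrtr// /dot (bigD1 i)//= -expr2 lerDl.
by apply: sumr_ge0 => j _; rewrite -expr2 sqr_ge0.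
Qed.

Lemma ler_norm_enorm n (x : 'rV[R]_n) : `|x| <= enorm x.
Proof.
rewrite [leLHS]/Num.norm /= mx_normrE; apply/bigmax_leP; split=> [|[i j] _ /=].
  exact: enorm_ge0.
by rewrite ord1 ler_coord_enorm.
Qed.

Lemma continuous_sum n (T : topologicalType) (V : normedModType R)
    (F : 'I_n -> T -> V) :
  (forall i, continuous (F i)) -> continuous (fun x => \sum_i F i x).
Proof.
move=> cF; elim: (index_enum _) => [|i r IH].
  by under eq_fun do rewrite big_nil; exact: cst_continuous.
under eq_fun do rewrite big_cons.
by move=> x; apply: cvgD; [exact: cF|exact: IH].
Qed.

Lemma dot_continuous n (T : topologicalType) (f g : T -> 'rV[R]_n) :
  continuous f -> continuous g -> continuous (fun x => dot (f x) (g x)).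
Proof.
move=> cf cg; apply: (@continuous_sum _ _ R^o) => i x.
have coord (h : T -> 'rV[R]_n) : continuous h -> continuous (fun y => h y ord0 i).
  by move=> ch y; exact: (continuous_comp (ch y) (@coord_continuous _ _ _ _ _ _)).
by apply: cvgM; exact: coord.
Qed.

Lemma mulmxr_continuous m n (U : 'M[R]_(m, n)) :
  continuous (fun x : 'rV[R]_m => x *m U).
Proof.
under eq_fun do rewrite mulmx_sum_row.
apply: continuous_sum => i x; apply: continuousZr_tmp.
exact: (@coord_continuous _ _ _ 0 i x).
Qed.

End dot.

(** * Hausdorff measure *)

Section hausdorff_measure.
Variables (R : realType).
Implicit Types n d : nat.

Lemma ball_volume_ge0 d : 0 <= ball_volume R d.
Proof. by apply: fine_ge0; exact: outer_measure_ge0. Qed.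

(** The unit ball lies in the cube of side 2, and this single box followed by empty sets is an
    admissible cover. The bound also shows the measure finite, so that [fine] can be undone. *)
Lemma ball_volume_le d : ball_volume R d <= 2 ^+ d.
Proof.
have h : (lebesgue [set x : 'rV[R]_d | (enorm x <= 1)%R] <= (2 ^+ d)%:E)%E.
  pose B := [set x : 'rV[R]_d | forall i,
    (const_mx (- 1) : 'rV[R]_d) ord0 i <= x ord0 i <=
    (const_mx 1 : 'rV[R]_d) ord0 i].
  pose F : (set 'rV[R]_d)^nat := fun k => if k == 0%N then B else set0.
  apply: (@le_trans _ _ (\sum_(k <oo) box_volume (F k))%E).
    apply: ereal_inf_lbound; exists F => // x /= x1.
    exists 0%N => // i; rewrite !mxE -ler_norml.
    exact: le_trans (ler_coord_enorm _ _) x1.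
  rewrite nneseries_recl//; last by move=> k _; exact: box_volume_ge0.
  rewrite eseries0 ?adde0; last by move=> [|k]// _ _; exact: box_volume0.
  apply: ereal_inf_lbound; right.
  exists (const_mx (-1)), (const_mx 1); split => //.
    by move=> i; rewrite !mxE; lra.
  congr (_%:E); under eq_bigr do rewrite !mxE.
  by rewrite prodr_const card_ord; congr (_ ^+ _); lra.
rewrite /ball_volume -lee_fin fineK// ge0_fin_numE; last exact: outer_measure_ge0.
exact: le_lt_trans h (ltry _).
Qed.

Lemma diameter_ge0 n (A : set 'rV[R]_n) : A !=set0 -> (0 <= diameter A)%E.
Proof.
move=> [x Ax]; apply: ereal_sup_ubound; exists x => //; exists x => //.
by rewrite subrr enorm0.
Qed.

Lemma hausdorff_gauge_ge0 n d delta (A : set 'rV[R]_n) :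
  (0 <= hausdorff_gauge d delta A)%E.
Proof.
rewrite /hausdorff_gauge; case: ifPn => // A0; case: ifPn => // _.
rewrite mule_ge0 ?expe_ge0 ?diameter_ge0//; last exact/set0P.
by rewrite lee_fin divr_ge0 ?ball_volume_ge0 ?exprn_ge0.
Qed.

Lemma hausdorff_gauge0 n d delta : hausdorff_gauge d delta (@set0 'rV[R]_n) = 0%E.
Proof. by rewrite /hausdorff_gauge eqxx. Qed.

Section hausdorff_outer_measure.
Variables (n d : nat).
Let T := 'rV[R]_n.

Let coverE delta : cover_outer (@hausdorff_gauge R n d delta) = mu_ext
  (hausdorff_gauge d delta : set (g_sigma_algebraType [set: set T]) -> \bar R).
Proof. exact: cover_outerE. Qed.

Lemma cover_gauge_ge0 delta (A : set T) :
  (0 <= cover_outer (hausdorff_gauge d delta) A)%E.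
Proof. by rewrite coverE; apply: mu_ext_ge0 => ?; exact: hausdorff_gauge_ge0. Qed.

Lemma cover_gauge_le_hausdorff delta (A : set T) : 0 < delta ->
  (cover_outer (hausdorff_gauge d delta) A <= hausdorff d A)%E.
Proof. by move=> d0; apply: ereal_sup_ubound; exists delta. Qed.

Let hausdorff0 : @hausdorff R n d set0 = 0%E.
Proof.
apply/eqP; rewrite eq_le; apply/andP; split.
  apply: ge_ereal_sup => _ [delta _ <-].
  rewrite coverE mu_ext0//; first exact: hausdorff_gauge0.
  by move=> ?; exact: hausdorff_gauge_ge0.
exact: le_trans (cover_gauge_ge0 1 _) (cover_gauge_le_hausdorff _ ltr01).
Qed.

Let hausdorff_ge0 A : (0 <= @hausdorff R n d A)%E.
Proof.
exact: le_trans (cover_gauge_ge0 1 _) (cover_gauge_le_hausdorff _ ltr01).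
Qed.

Let le_hausdorff : {homo @hausdorff R n d : A B / A `<=` B >-> (A <= B)%E}.
Proof.
move=> A B AB; apply: ge_ereal_sup => _ [delta d0 <-].
apply: le_trans (cover_gauge_le_hausdorff _ d0).
apply/ereal_inf_le_tmp => x [F BF <-{x}].
by exists F => //; exact: subset_trans AB BF.
Qed.

Let hausdorff_sigma_subadditive : sigma_subadditive (@hausdorff R n d).
Proof.
move=> F; apply: ge_ereal_sup => _ [delta d0 <-].
apply: (@le_trans _ _
    (\sum_(k <oo) cover_outer (hausdorff_gauge d delta) (F k))%E).
  rewrite coverE; apply: (@mu_ext_sigma_subadditive _
    (g_sigma_algebraType [set: set T])) => ?.
  exact: hausdorff_gauge_ge0.
apply: lee_nneseries => k *; first exact: cover_gauge_ge0.
exact: cover_gauge_le_hausdorff.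
Qed.

HB.instance Definition _ := isOuterMeasure.Build R _ (@hausdorff R n d)
  hausdorff0 hausdorff_ge0 le_hausdorff hausdorff_sigma_subadditive.

End hausdorff_outer_measure.

End hausdorff_measure.

(** * Hausdorff measure under expanding maps *)

Section hausdorff_expansion.
Variable R : realType.

Lemma le_cover_outer (T : Type) (g g' : set T -> \bar R) A :
  (forall B, 0 <= g B)%E -> (forall B, g B <= g' B)%E ->
  (cover_outer g A <= cover_outer g' A)%E.
Proof.
move=> g0 gg'; apply: le_ereal_inf_tmp => _ [F AF <-].
apply: (@le_trans _ _ (\sum_(k <oo) g (F k))%E).
  by apply: ereal_inf_lbound; exists F.
exact: lee_nneseries.
Qed.

Lemma hausdorff_gauge_antitone n d (e e' : R) (A : set 'rV[R]_n) :
  e <= e' -> (hausdorff_gauge d e' A <= hausdorff_gauge d e A)%E.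
Proof.
move=> ee'; rewrite /hausdorff_gauge; case: ifPn => // A0.
case: (leP (diameter A) e%:E) => [Ae|_]; last by rewrite leey.
by rewrite (le_trans Ae) ?lee_fin.
Qed.

(* At most one of the preimages of a set of diameter less than [eta] is
   nonempty. *)
Lemma hausdorff_gauge_preimages K n1 n2 d (S : set 'rV[R]_n1)
    (f : 'I_K -> 'rV[R]_n1 -> 'rV[R]_n2) (L eta delta : R) (F : set 'rV[R]_n2) :
  0 < L -> delta < eta ->
  (forall i x y, S x -> S y -> enorm (x - y) <= L * enorm (f i x - f i y)) ->
  (forall i j x y, i != j -> S x -> S y -> eta <= enorm (f i x - f j y)) ->
  (\sum_(i < K) hausdorff_gauge d (L * delta)%R (S `&` f i @^-1` F)
     <= (L ^+ d)%:E * hausdorff_gauge d delta F)%E.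
Proof.
move=> L0 de fL fe.
have [[i [x [Sx Fx]]]|h] := pselect (exists i, S `&` f i @^-1` F !=set0); last first.
  rewrite big1 ?mule_ge0 ?hausdorff_gauge_ge0 ?lee_fin ?exprn_ge0 ?ltW//.
  move=> i _; rewrite (_ : _ `&` _ = set0) ?hausdorff_gauge0//.
  by apply/eqP/negPn/negP => /set0P S0; apply: h; exists i.
have F0 : F != set0 by apply/set0P; exists (f i x).
rewrite {2}/hausdorff_gauge (negbTE F0).
case: (leP (diameter F) delta%:E) => [Fd|_]; last first.
  by rewrite gt0_muley ?leey// lte_fin exprn_gt0.
have enF y z : F y -> F z -> ((enorm (y - z))%:E <= diameter F)%E.
  by move=> Fy Fz; apply: ereal_sup_ubound; exists y => //; exists z.
have Ffin : (diameter F)%E \is a fin_num.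
  rewrite ge0_fin_numE ?diameter_ge0//; last exact/set0P.
  exact: le_lt_trans Fd (ltry _).
have i0 : S `&` f i @^-1` F != set0 by apply/set0P; exists x.
rewrite (bigD1 i)//= big1 ?adde0; last first.
  move=> j ji; rewrite (_ : _ `&` _ = set0) ?hausdorff_gauge0//.
  apply/eqP/negPn/negP => /set0P[y [Sy Fy]].
  have := le_trans (enF _ _ Fy Fx) Fd; rewrite lee_fin leNgt => /negP; apply.
  exact: lt_le_trans de (fe _ _ _ _ ji Sy Sx).
have diamL : (diameter (S `&` f i @^-1` F) <= L%:E * diameter F)%E.
  apply: ge_ereal_sup => _ [y [Sy Fy] [z [Sz Fz] <-]].
  rewrite -(fineK Ffin) -EFinM lee_fin (le_trans (fL i _ _ Sy Sz))//.
  by rewrite ler_pM2l// -lee_fin fineK// enF.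
rewrite /hausdorff_gauge (negbTE i0) ifT; last first.
  apply: le_trans diamL _; rewrite -(fineK Ffin) -EFinM lee_fin ler_pM2l//.
  by rewrite -lee_fin fineK.
rewrite muleCA lee_wpmul2l//.
  by rewrite lee_fin divr_ge0 ?ball_volume_ge0 ?exprn_ge0.
rewrite -(fineK Ffin) in diamL *.
have Gfin : diameter (S `&` f i @^-1` F) \is a fin_num.
  rewrite ge0_fin_numE ?diameter_ge0//; last exact/set0P.
  by apply: le_lt_trans diamL _; rewrite -EFinM ltry.
have G0 := diameter_ge0 ((set0P _).1 i0).
rewrite -(fineK Gfin) in diamL G0 *.
rewrite -!EFin_expe -EFinM lee_fin -exprMn.
by rewrite -EFinM !lee_fin in diamL G0; rewrite lerXn2r ?nnegrE// (le_trans G0).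
Qed.

(** The images of the [f i] are [K] separated copies of [S] inside [T]. A cover of [T] pulls back to
    a cover of [S] along each [f i]; once its pieces are smaller than [eta], each piece serves at
    most one [i], so the [K] pulled-back sums together cost at most [L ^+ d] times the original one.
    No measurability is involved. *)
Lemma hausdorff_expand K n1 n2 d (S : set 'rV[R]_n1) (T : set 'rV[R]_n2)
    (f : 'I_K -> 'rV[R]_n1 -> 'rV[R]_n2) (L eta : R) :
  0 < L -> 0 < eta -> (forall i x, S x -> T (f i x)) ->
  (forall i x y, S x -> S y -> enorm (x - y) <= L * enorm (f i x - f i y)) ->
  (forall i j x y, i != j -> S x -> S y -> eta <= enorm (f i x - f j y)) ->
  (K%:R%:E * hausdorff d S <= (L ^+ d)%:E * hausdorff d T)%E.
Proof.
move=> L0 eta0 fT fL fe.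
have Ld0 : 0 < L ^+ d by exact: exprn_gt0.
case: K => [|K] in f fT fL fe *.
  by rewrite mul0e mule_ge0// ?outer_measure_ge0// lee_fin ltW.
have K0 : 0 < K.+1%:R :> R by [].
rewrite -lee_pdivlMl//; apply: ge_ereal_sup => _ [delta delta0 <-].
rewrite lee_pdivlMl//.
(* Pieces of diameter at most [e] are smaller than [eta], and their preimages have diameter at most
   [delta]. *)
pose e := Num.min (delta / L) (eta / 2).
have e0 : 0 < e by rewrite lt_min !divr_gt0.
have eeta : e < eta.
  by rewrite gt_min; apply/orP; right; rewrite ltr_pdivrMr// ltr_pMr// ltr1n.
have Le : L * e <= delta.
  by rewrite mulrC -ler_pdivlMr// ge_min lexx.
apply: (@le_trans _ _ ((L ^+ d)%:E * cover_outer (hausdorff_gauge d e) T)%E);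
  last by rewrite lee_pmul2l ?cover_gauge_le_hausdorff// lte_fin.
rewrite -lee_pdivrMl//; apply: le_ereal_inf_tmp => _ [F TF <-].
rewrite lee_pdivrMl// -nneseriesZl; last by move=> *; exact: hausdorff_gauge_ge0.
apply: (@le_trans _ _ (\sum_(k <oo) \sum_(i < K.+1)
   hausdorff_gauge d (L * e)%R (S `&` f i @^-1` F k))%E); last first.
  apply: lee_nneseries => [k _ _|k _].
    by apply: sume_ge0 => *; exact: hausdorff_gauge_ge0.
  exact: (hausdorff_gauge_preimages d _ L0 eeta fL fe).
rewrite nneseries_sum; last by move=> *; exact: hausdorff_gauge_ge0.
apply: (@le_trans _ _ (\sum_(i < K.+1) cover_outer (hausdorff_gauge d delta) S)%E).
  by rewrite mule_natl big_const_ord -Monoid.iteropE.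
apply: lee_sum => i _.
apply: (@le_trans _ _ (cover_outer (hausdorff_gauge d (L * e)) S)).
  apply: le_cover_outer => B; first exact: hausdorff_gauge_ge0.
  exact: hausdorff_gauge_antitone.
apply: ereal_inf_lbound; exists (fun k => S `&` f i @^-1` F k) => // x Sx.
by have [k _ Fk] := TF _ (fT i _ Sx); exists k.
Qed.

Lemma hausdorff_expand1 n1 n2 d (S : set 'rV[R]_n1) (T : set 'rV[R]_n2)
    (f : 'rV[R]_n1 -> 'rV[R]_n2) (L : R) : 0 < L -> (forall x, S x -> T (f x)) ->
  (forall x y, S x -> S y -> enorm (x - y) <= L * enorm (f x - f y)) ->
  (hausdorff d S <= (L ^+ d)%:E * hausdorff d T)%E.
Proof.
move=> L0 fT fL.
have := @hausdorff_expand 1 _ _ d S T (fun=> f) L 1 L0 ltr01.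
by rewrite mul1e; apply => // i j x y; rewrite !ord1 eqxx.
Qed.

Lemma hausdorff_isom n1 n2 d (S : set 'rV[R]_n1) (T : set 'rV[R]_n2)
    (f : 'rV[R]_n1 -> 'rV[R]_n2) : (forall x, S x -> T (f x)) ->
  (forall x y, S x -> S y -> enorm (x - y) <= enorm (f x - f y)) ->
  (hausdorff d S <= hausdorff d T)%E.
Proof.
move=> fT fL; have := @hausdorff_expand1 _ _ d S T f 1 ltr01 fT.
by rewrite expr1n mul1e; apply => x y Sx Sy; rewrite mul1r fL.
Qed.

(** This is the limit as [L] tends to 1, made explicit for real values by a linear bound on
    [(1 + e) ^+ m]. *)
Lemma lee_of_le_expr_mul (m : nat) (a b : \bar R) : (0 <= a)%E ->
  (forall L : R, 1 < L -> (b <= (L ^+ m)%:E * a)%E) -> (b <= a)%E.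
Proof.
case: a => [r| |]// r0 h; last exact: leey.
rewrite lee_fin in r0.
have pow (e : R) : 0 < e <= 1 -> (1 + e) ^+ m <= 1 + 3 ^+ m * e.
  move=> /andP[e0 e1]; elim: m {h} => [|m IH]; first by rewrite !expr0; lra.
  have m1 : (1 : R) <= 3 ^+ m by apply: exprn_ege1; lra.
  rewrite !exprS; apply: le_trans (ler_wpM2l _ IH) _; first by lra.
  move: (3 ^+ m) m1 => t t1.
  have : 0 <= t * e * (1 - e) by rewrite !mulr_ge0//; lra.
  have : 0 <= e * (t - 1) by rewrite !mulr_ge0//; lra.
  lra.
case: b h => [s| |] h; last by rewrite leNye.
  rewrite lee_fin; apply/ler_addgt0Pr => e e0.
  have m1 : (0 : R) < 3 ^+ m by apply: exprn_gt0.
  (* This gives [3 ^+ m * d * r <= e]; the [+ 1] keeps the denominator positive when [r = 0]. *)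
  pose d := Num.min 1 (e / (3 ^+ m * (r + 1))).
  have d0 : 0 < d by rewrite lt_min ltr01 divr_gt0// mulr_gt0//; lra.
  have d1 : d <= 1 by rewrite ge_min lexx.
  have hs : s <= (1 + d) ^+ m * r by rewrite -lee_fin; apply: h; lra.
  apply: (le_trans hs); apply: le_trans (ler_wpM2r r0 (pow d _)) _.
    by rewrite d0 d1.
  have : d <= e / (3 ^+ m * (r + 1)) by rewrite ge_min lexx orbT.
  rewrite ler_pdivlMr ?mulr_gt0//; last lra.
  have : 0 <= 3 ^+ m * d by rewrite mulr_ge0 ?ltW.
  lra.
have /h : 1 < 2 :> R by lra.
by rewrite -EFinM leye_eq.
Qed.

End hausdorff_expansion.

(** * Tilings by translates of a parallelepiped *)

Section tiling.
Variable R : realType.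

Lemma outer_measure_le_card (T : Type) (mu : {outer_measure set T -> \bar R})
    (I : finType) (F : I -> set T) (b : \bar R) : (forall i, mu (F i) <= b)%E ->
  (mu (\bigcup_i F i) <= #|I|%:R%:E * b)%E.
Proof.
move=> Fb.
suff h (s : seq I) : (mu [set x | exists2 i, i \in s & F i x] <=
    (size s)%:R%:E * b)%E.
  rewrite cardE; apply: le_trans (h _); apply: le_outer_measure.
  by move=> x [i _ Fx]; exists i => //; rewrite mem_enum.
elim: s => [|i s IH].
  rewrite mul0e (_ : [set _ | _] = set0) ?outer_measure0//.
  by apply/seteqP; split=> // x [].
apply: (@le_trans _ _ (mu (F i `|` [set x | exists2 i, i \in s & F i x]))%E).
  apply: le_outer_measure => x [j]; rewrite inE => /predU1P[->|js] Fx.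
    by left.
  by right; exists j.
apply: le_trans (outer_measureU2 _ _ _) _ => /=.
by rewrite -add1n natrD EFinD ge0_muleDl ?lee_fin// mul1e leeD.
Qed.

(* The integer translates of the unitriangular parallelepiped with edges given by
   [a] cover the space. *)
Lemma triangular_tiling m (a : 'I_m -> 'I_m -> R) (x : 'I_m -> R) :
  exists (s : 'I_m -> R) (k : 'I_m -> int), (forall j, 0 <= s j <= 1) /\
    forall j, x j = (k j)%:~R + s j + \sum_(i < m | (j < i)%N) s i * a i j.
Proof.
(* The equation at [j] involves only the [s i] with [i >= j], so the coordinates are solved from the
   last to the first; [r] counts those already solved. *)
suff h r : exists (s : 'I_m -> R) (k : 'I_m -> int), (forall j, 0 <= s j <= 1) /\
    forall j : 'I_m, (m <= j + r)%N ->
    x j = (k j)%:~R + s j + \sum_(i < m | (j < i)%N) s i * a i j.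
  by have [s [k [s01 sk]]] := h m; exists s, k; split=> // j; rewrite sk// leq_addl.
elim: r => [|r [s [k [s01 IH]]]].
  exists (fun=> 0), (fun=> 0); split=> [j|j]; first by rewrite lexx ler01.
  by rewrite addn0 leqNgt ltn_ord.
have [rm|mr] := ltnP r m; last first.
  by exists s, k; split => // j _; apply: IH; rewrite (leq_trans mr) ?leq_addl.
have j0m : (m - r.+1 < m)%N by rewrite ltn_subrL /= (leq_ltn_trans _ rm).
pose j0 := Ordinal j0m.
(* What the later edges leave of [x j0]: its integer part becomes the lattice coordinate, its
   fractional part becomes [s' j0]. *)
pose v := x j0 - \sum_(i < m | (j0 < i)%N) s i * a i j0.
pose s' i := if i == j0 then v - (Num.floor v)%:~R else s i.
exists s', (fun i => if i == j0 then Num.floor v else k i); split=> j.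
  rewrite /s'; case: eqP => // _; have := Num.Theory.floor_le v.
  by have := Num.Theory.floorD1_gt v; rewrite intrD; lra.
move=> mj; have [{mj}->|jj0] := eqVneq j j0.
  rewrite {1}/s' eqxx subrKC (eq_bigr (fun i => s i * a i j0)) ?subrK//.
  by move=> i ji; rewrite /s' ifN// -val_eqE gtn_eqF.
have j0j : (j0 < j)%N by move: jj0; rewrite -val_eqE /=; lia.
rewrite IH; last by move: j0j => /=; lia.
rewrite {1}/s' (negbTE jj0); congr (_ + _); apply: eq_bigr => i ji.
by rewrite /s' ifN// -val_eqE gtn_eqF// (ltn_trans j0j).
Qed.

Definition box m (l : 'I_m -> R) : set 'rV[R]_m :=
  [set x | forall j, 0 <= x ord0 j <= l j].

(* About [N ^ m] translates of [A] cover the box [N l], whose measure is [N ^ m]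
   times that of the box [l]. *)
Lemma hausdorff_box_le_tile m (l : 'I_m -> R) (A : set 'rV[R]_m) (C : nat) :
  (forall j, 0 < l j) ->
  (forall y j, A y -> `|y ord0 j| <= C%:R * l j) ->
  (forall x, exists k : 'I_m -> int, A (x - \row_j ((k j)%:~R * l j))) ->
  (hausdorff m (box l) <= hausdorff m A)%E.
Proof.
move=> l0 AC tile; apply: (@lee_of_le_expr_mul _ m).
  exact: outer_measure_ge0.
move=> L L1.
(* Along each axis, [N + 2 * C + 1] translates will be used for a box [N] times as long; for large
   [N] the ratio is at most [L]. *)
have [N N0 NL] : exists2 N : nat, 0 < N%:R :> R & (N + 2 * C).+1%:R <= L * N%:R.
  exists (Num.truncn ((2 * C).+1%:R / (L - 1))).+1 => //.
  have := truncnS_gt ((2 * C).+1%:R / (L - 1)); move: (Num.truncn _).+1 => N.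
  by rewrite ltr_pdivrMr ?subr_gt0// -addnS natrD; lra.
pose B := box (fun j => N%:R * l j).
apply: (@le_trans _ _ ((N%:R^-1 ^+ m)%:E * hausdorff m B)%E).
  apply: (hausdorff_expand1 m (f := fun x => N%:R *: x)).
  - by rewrite invr_gt0.
  - move=> x xl j; rewrite mxE; have := xl j.
    by rewrite !(ler_pM2l, pmulr_rge0).
  - move=> x y _ _; rewrite -scalerBr enormZ gtr0_norm// mulrA mulVf ?mul1r//.
    exact: lt0r_neq0.
(* Only lattice coordinates between [- C] and [N + C] can reach the big box; [K] stores them shifted
   by [C]. *)
pose F (K : {ffun 'I_m -> 'I_(N + 2 * C).+1}) : set 'rV[R]_m :=
  [set x | A (x - \row_j (((K j)%:Z - C%:Z)%:~R * l j))].
have FA K : (hausdorff m (F K) <= hausdorff m A)%E.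
  apply: (hausdorff_isom m (f := fun x => x - \row_j (((K j)%:Z - C%:Z)%:~R * l j))).
    by [].
  by move=> x y _ _; rewrite opprB addrA subrK.
have BF : B `<=` \bigcup_K F K.
  move=> x Bx; have [k Ak] := tile x.
  have kb j : - C%:Z <= k j <= N%:Z + C%:Z.
    have := AC _ j Ak; rewrite !mxE ler_norml => /andP[b3 b4].
    have /andP[b1 b2] := Bx j.
    rewrite -!(ler_int R) rmorphN rmorphD /= -!pmulrn.
    by apply/andP; split; rewrite -(ler_pM2r (l0 j)); lra.
  have k0 j : 0 <= k j + C%:Z by have /andP[] := kb j; rewrite -subr_ge0 opprK.
  have kN j : (absz (k j + C%:Z)%R < (N + 2 * C).+1)%N.
    have /andP[_] := kb j; rewrite -(lerD2r C%:Z) -ltz_nat gez0_abs//.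
    by rewrite -addn1 addrAC -!PoszD => /le_lt_trans; apply; rewrite ltz_nat; lia.
  exists [ffun j => inord (absz (k j + C%:Z))] => //; rewrite /F /=.
  rewrite (_ : \row_j _ = \row_j ((k j)%:~R * l j))//.
  by apply/rowP => j; rewrite !mxE ffunE inordK// gez0_abs// addrK.
apply: (@le_trans _ _ ((N%:R^-1 ^+ m)%:E *
    (((N + 2 * C).+1 ^ m)%:R%:E * hausdorff m A))%E).
  apply: lee_wpmul2l; first by rewrite lee_fin exprn_ge0// invr_ge0 ltW.
  apply: (@le_trans _ _ (hausdorff m (\bigcup_K F K))).
    exact: le_outer_measure.
  by have := outer_measure_le_card FA; rewrite card_ffun !card_ord.
rewrite muleA -EFinM lee_wpmul2r ?outer_measure_ge0// lee_fin.
rewrite natrX -exprMn lerXn2r ?nnegrE ?mulr_ge0 ?invr_ge0 ?ler0n//; first lra.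
by rewrite mulrC ler_pdivrMr.
Qed.

End tiling.

(** * Convex sets *)

Section convex_geometry.
Variables (R : realType) (n : nat).
Implicit Types (x y z c : 'rV[R]_n) (A Omega : set 'rV[R]_n).

Lemma closureP A x :
  closure A x <-> forall e : R, 0 < e -> exists2 y, A y & `|x - y| < e.
Proof.
split=> [clA e e0|h B /nbhs_ballP[e e0 eB]].
  have [y [Ay xy]] := clA _ (nbhsx_ballx x e e0); exists y => //.
  by rewrite -ball_normE in xy.
by have [y Ay xy] := h e e0; exists y; split=> //; apply: eB; rewrite -ball_normE.
Qed.

Lemma interiorP A x :
  interior A x <-> exists2 e : R, 0 < e & forall y, `|x - y| < e -> A y.
Proof.
split=> [/nbhs_ballP[e e0 eA]|[e e0 eA]].
  by exists e => // y xy; apply: eA; rewrite -ball_normE.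
by apply/nbhs_ballP; exists e => // y; rewrite -ball_normE; exact: eA.
Qed.

Definition convex_prop A := forall x y (t : R), A x -> A y -> 0 <= t <= 1 ->
  A ((1 - t) *: x + t *: y).

Lemma convex_set_prop A : convex_set (A : set (convex_lmodType 'rV[R]_n)) ->
  convex_prop A.
Proof.
move=> cA x y t Ax Ay /andP[t0 t1].
have := cA y x (Itv01 t0 t1) (mem_set Ay) (mem_set Ax).
rewrite inE => h; rewrite addrC; exact: h.
Qed.

Lemma convex_closure A : convex_prop A -> convex_prop (closure A).
Proof.
move=> cA x y t /closureP clx /closureP cly /andP[t0 t1]; apply/closureP => e e0.
have [x' Ax xx'] := clx _ e0; have [y' Ay yy'] := cly _ e0.
exists ((1 - t) *: x' + t *: y'); first by apply: cA => //; rewrite t0.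
rewrite opprD addrACA -!scalerBr; apply: le_lt_trans (ler_normD _ _) _.
rewrite !normrZ (ger0_norm t0) ger0_norm ?subr_ge0//.
have [->|t10] := eqVneq t 0; first by rewrite mul0r subr0 mul1r addr0.
have tp : 0 < t by rewrite lt_neqAle eq_sym t10.
have : t * `|y - y'| < t * e by rewrite ltr_pM2l.
have : (1 - t) * `|x - x'| <= (1 - t) * e.
  by apply: ler_wpM2l; [rewrite subr_ge0|exact: ltW].
by lra.
Qed.

(** Replace [y] by a nearby point [y'] of [A] and compensate by moving [c] by [(1 - t) / t] times
    the error, which stays in the ball around [c]. *)
Lemma convex_closure_interior A c y (t : R) : convex_prop A ->
  interior A c -> closure A y -> 0 < t <= 1 -> A ((1 - t) *: y + t *: c).
Proof.
move=> cA /interiorP[e e0 eA] /closureP cly /andP[t0 t1].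
have [->|t1'] := eqVneq t 1.
  rewrite subrr scale0r add0r scale1r; apply: eA.
  by rewrite subrr normr0.
have t10 : 0 < 1 - t by rewrite subr_gt0 lt_neqAle t1'.
have [y' Ay' yy'] := cly (t * e / (1 - t)) (divr_gt0 (mulr_gt0 t0 e0) t10).
rewrite (_ : _ + _ = (1 - t) *: y' + t *: (c + ((1 - t) / t) *: (y - y'))).
  apply: cA => //; last by rewrite ltW.
  apply: eA; rewrite opprD addrA subrr add0r normrN normrZ.
  rewrite ger0_norm; last by rewrite divr_ge0 ?ltW.
  by rewrite mulrAC ltr_pdivrMr// mulrC (mulrC e) -ltr_pdivlMr.
rewrite scalerDr scalerA mulrCA mulfV ?mulr1 ?gt_eqF// addrCA -scalerDr.
by rewrite [y' + _]addrC subrK addrC.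
Qed.

(** Any [z] close to the combination is the same combination with [c] displaced by [t^-1] times the
    difference, hence with another interior point. *)
Lemma convex_closure_interior_interior A c y (t : R) : convex_prop A ->
  interior A c -> closure A y -> 0 < t <= 1 ->
  interior A ((1 - t) *: y + t *: c).
Proof.
move=> cA Ac Ay /andP[t0 t1]; have := open_interior A; rewrite openE => /(_ _ Ac).
move=> /interiorP[e e0 eA]; apply/interiorP; exists (t * e); first exact: mulr_gt0.
move=> z zt.
rewrite (_ : z = (1 - t) *: y + t *: (c + t^-1 *: (z - ((1 - t) *: y + t *: c)))).
  apply: convex_closure_interior => //; last by rewrite t0.
  apply: eA; rewrite opprD addrA subrr add0r normrN normrZ distrC.
  by rewrite gtr0_norm ?invr_gt0// mulrC ltr_pdivrMr// mulrC.
by rewrite scalerDr scalerA mulfV ?gt_eqF// scale1r addrA addrC subrK.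
Qed.

Lemma convex_average A (x : nat -> 'rV[R]_n) k : convex_prop A ->
  (forall i, (i <= k)%N -> A (x i)) -> A (k.+1%:R^-1 *: \sum_(i < k.+1) x i).
Proof.
move=> cA; elim: k => [|k IH] Ax.
  by rewrite big_ord_recr big_ord0 /= add0r invr1 scale1r; exact: Ax.
have := cA _ _ (k.+2%:R^-1) (IH (fun i ik => Ax i (leqW ik))) (Ax _ (leqnn _)).
rewrite invr_ge0 ler0n invf_le1 ?ler1n ?ltr0n//= => /(_ isT).
rewrite [in X in _ -> X]big_ord_recr /= scalerDr scalerA; congr (A (_ *: _ + _)).
have k1 : k.+1%:R != 0 :> R by rewrite pnatr_eq0.
have k2 : k.+2%:R != 0 :> R by rewrite pnatr_eq0.
rewrite -[k.+2%:R]natr1 in k2 *; move: k.+1%:R k1 k2 => a a0 a1.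
by field; rewrite a0 a1.
Qed.

Lemma nearest_point K y : compact K -> K !=set0 -> convex_prop K ->
  exists x, [/\ K x, forall z, K z -> dot (z - x) (y - x) <= 0 &
                forall z, K z -> enorm (y - x) <= enorm (y - z)].
Proof.
move=> cK K0 convK.
have dc : continuous (fun z : 'rV[R]_n => dot (y - z) (y - z)).
  by apply: dot_continuous => z; exact: cvgB (cvg_cst _) cvg_id.
have [x] := EVT_min_rV K0 cK (continuous_subspaceT dc).
rewrite inE => Kx xmin; exists x; split => // z Kz; last first.
  by apply: ler_enorm; apply: xmin; rewrite inE.
rewrite leNgt; apply/negP => D0.
(* If [D > 0], moving from [x] towards [z] by [t] changes the squared distance to [y] by
   [- 2 t D + t ^ 2 M]. The choice of [t] makes [t M <= D], so the change is negative, against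
   minimality. *)
set D := dot _ _ in D0; set M := dot (z - x) (z - x).
have M0 : 0 <= M by exact: dot_ge0.
pose t := Num.min 1 (D / (M + 1)).
have t0 : 0 < t by rewrite lt_min ltr01 divr_gt0//; lra.
have t1 : t <= 1 by rewrite ge_min lexx.
have tM : t * (M + 1) <= D.
  by rewrite -ler_pdivlMr ?ge_min ?lexx ?orbT//; lra.
have := xmin ((1 - t) *: x + t *: z); rewrite inE.
move=> /(_ (convK _ _ _ Kx Kz _)); rewrite t1 ltW// => /(_ isT).
rewrite (_ : y - (_ + _) = (y - x) - t *: (z - x)); last first.
  by rewrite scalerBl scale1r scalerBr !opprD !opprK !addrA addrAC.
have -> : dot (y - x - t *: (z - x)) (y - x - t *: (z - x)) =
    dot (y - x) (y - x) - 2 * (t * D) + t * t * M.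
  rewrite /D /M; move: (z - x) (y - x) => v w.
  by rewrite !dot_lin (dotC w v); ring.
have : t * t * M <= t * D by rewrite -mulrA ler_pM2l//; lra.
have : 0 < t * D by exact: mulr_gt0.
by lra.
Qed.

End convex_geometry.

(** * Faces of a box *)

Section box_boundary.
Variable R : realType.

Definition face n (lo hi : 'I_n -> R) (p : 'I_n * bool) : set 'rV[R]_n :=
  [set v | forall j, if j == p.1 then v ord0 j = (if p.2 then hi j else lo j)
                     else lo j <= v ord0 j <= hi j].

Lemma compact_bigcup_fin (T : topologicalType) (I : finType) (F : I -> set T) :
  (forall i, compact (F i)) -> compact (\bigcup_i F i).
Proof.
move=> cF; rewrite (_ : \bigcup_i F i = \big[setU/set0]_i F i).
  exact: bigsetU_compact.
apply/seteqP; split=> [x [i _ Fx]|x].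
  by rewrite (bigD1 i)//=; left.
by elim/big_rec : _ => // i B _ IH [Fx|/IH//]; exists i.
Qed.

Lemma compact_face n (lo hi : 'I_n -> R) p : compact (face lo hi p).
Proof.
pose A j : set R :=
  if j == p.1 then [set (if p.2 then hi j else lo j)] else `[lo j, hi j]%classic.
have cA j : compact (A j).
  by rewrite /A; case: ifP => _; [exact: compact_set1|exact: segment_compact].
rewrite (_ : face lo hi p = [set v | forall j, A j (v ord0 j)]).
  exact: rV_compact.
apply/seteqP; split=> v vA j; have := vA j; rewrite /A; case: ifP => //= _;
  by rewrite in_itv.
Qed.

(** [s i] is the time at which the ray reaches the side it heads for in coordinate [i]. The smallest
    of these over the coordinates that move is the exit time. *)
Lemma box_exit n (lo hi : 'I_n -> R) (x u : 'rV[R]_n) : u != 0 ->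
  (forall j, lo j <= x ord0 j <= hi j) ->
  exists2 t, 0 <= t & (\bigcup_p face lo hi p) (x + t *: u).
Proof.
move=> u0 xlh.
have [i0 ui0] : exists i, u ord0 i != 0.
  apply/existsP; apply: contraNT u0; rewrite negb_exists => /forallP u0.
  by apply/eqP/rowP => i; rewrite mxE; apply/eqP/negPn.
pose s i := ((if 0 < u ord0 i then hi i else lo i) - x ord0 i) / u ord0 i.
have s0 i : u ord0 i != 0 -> 0 <= s i.
  rewrite /s; have /andP[h1 h2] := xlh i; case: ltgtP => //= ui _.
    by rewrite divr_ge0 ?(ltW ui)//; lra.
  by rewrite -mulrNN mulr_ge0//; [lra|rewrite oppr_ge0 invr_le0 ltW].
case: (@Order.TotalTheory.arg_minP _ _ _ i0 (fun i => u ord0 i != 0) s ui0) => i ui imin.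
exists (s i); first exact: s0.
exists (i, 0 < u ord0 i) => // j /=; rewrite !mxE.
case: eqP => [->|_]; first by rewrite /s divfK// addrC subrK.
have /andP[h1 h2] := xlh j; have si0 := s0 _ ui.
have [->|uj] := eqVneq (u ord0 j) 0; first by rewrite mulr0 addr0 xlh.
have := imin _ uj; rewrite {2}/s; case: ltgtP uj => //= uj _.
  rewrite ler_pdivlMr// => h.
  have : 0 <= s i * u ord0 j by rewrite mulr_ge0// ltW.
  lra.
rewrite ler_ndivlMr// => h.
have : 0 <= s i * - u ord0 j by rewrite mulr_ge0// oppr_ge0 ltW.
lra.
Qed.

End box_boundary.

(** * The boundary of a convex set inside a box *)

Section boundary_in_box.
Variables (R : realType) (n : nat).
Variables (Omega : set 'rV[R]_n) (U : 'M[R]_n) (lo hi : 'I_n -> R).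
Hypotheses (bOmega : bounded_set Omega) (cOmega : convex_prop Omega)
  (iOmega : interior Omega !=set0) (UU : U *m U^T = 1%:M)
  (OmegaB : forall x j, closure Omega x -> lo j <= (x *m U^T) ord0 j <= hi j).

Lemma compact_closure : compact (closure Omega).
Proof.
apply: bounded_closed_compact; last exact: closed_closure.
have [M [Mr OM]] := bOmega; exists (M + 1); split; first by rewrite num_real.
move=> N MN x /closureP clx; apply/ler_addgt0Pr => e e0.
have [y Oy xy] := clx e e0.
rewrite -(subrK y x) addrC (le_trans (ler_normD _ _))// lerD ?(ltW xy)//.
by apply: OM Oy; apply: lt_trans MN; rewrite ltrDl.
Qed.

(* The pairs [(x, b)] with [b *m U - x] in the normal cone of [Omega] at [x]
   form a compact set, so it is enough to find [b] for the nearest points [x] of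
   points outside [Omega]: there the normal ray is followed until it exits. *)
Lemma boundary_normal x : boundary Omega x ->
  exists2 b, (\bigcup_p face lo hi p) b &
    forall z, closure Omega z -> dot (z - x) (b *m U - x) <= 0.
Proof.
move=> [clx nix].
pose M := \bigcup_p face lo hi p.
pose N (z : 'rV[R]_n) : set ('rV[R]_n * 'rV[R]_n) :=
  [set p | dot (z - p.1) (p.2 *m U - p.1) <= 0].
pose P := (closure Omega `*` M) `&` \bigcap_(z in closure Omega) N z.
suff : (fst @` P) x.
  by move=> [[x' b] /= [[_ Mb] Nb] <-]; exists b => // z Kz; exact: Nb.
have cP : compact P.
  have cKM : compact (closure Omega `*` M).
    apply: compact_setX; first exact: compact_closure.
    by apply: compact_bigcup_fin => p; exact: compact_face.
  have clN : closed (\bigcap_(z in closure Omega) N z).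
    apply: closed_bigI => z _.
    have cN : continuous (fun p : 'rV[R]_n * 'rV[R]_n =>
        dot (z - p.1) (p.2 *m U - p.1)).
      apply: dot_continuous => p.
        exact: cvgB (cvg_cst _) cvg_fst.
      apply: cvgB; last exact: cvg_fst.
      apply: (@cvg_comp _ _ _ snd (mulmxr U) (nbhs p) (nbhs p.2)).
        exact: cvg_snd.
      exact: mulmxr_continuous.
    by apply: (@closed_comp _ _ _ [set r : R | r <= 0] (fun p _ => cN p)); exact: closed_le.
  apply: (subclosed_compact _ cKM); last by move=> ? [].
  apply: closedI clN; apply: compact_closed cKM.
  exact: norm_hausdorff.
(* The projection of the compact [P] is closed, so it suffices to find points of it arbitrarily
   close to [x]. *)
suff : closure (fst @` P) x.
  have /closure_id <- // : closed (fst @` P).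
  apply: compact_closed; first exact: norm_hausdorff.
  by apply: continuous_compact cP; apply: continuous_subspaceT => p; exact: cvg_fst.
apply/closureP => e e0; have [c ic] := iOmega.
(* [y] lies beyond [x] as seen from the interior point [c], at distance less than [e / 2] from
   [x]. *)
pose s := e / (2 * enorm (x - c) + 1).
have D0 : 0 < 2 * enorm (x - c) + 1 by have := enorm_ge0 (x - c); lra.
have s0 : 0 < s by rewrite divr_gt0.
pose y := x + s *: (x - c).
have Ky : ~ closure Omega y.
  move=> Ky; apply: nix.
  (* With this weight on [c], the combination of [y] and [c] is [x], which would then be
     interior. *)
  have t01 : 0 < s / (1 + s) <= 1.
    have s1 : 0 < 1 + s by lra.
    by rewrite divr_gt0//= ler_pdivrMr//; lra.
  have := convex_closure_interior_interior cOmega ic Ky t01; congr (interior _ _).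
  have s1 : 1 + s != 0 by rewrite gt_eqF//; lra.
  apply/rowP => i; rewrite !mxE; field.
  exact: s1.
have [x' [Kx' nx' dx']] := nearest_point y compact_closure
  (ex_intro _ _ clx) (convex_closure cOmega).
have yx'0 : y - x' != 0.
  by apply/eqP => /eqP; rewrite subr_eq0 => /eqP yx'; apply: Ky; rewrite yx'.
have UTU : U^T *m U = 1%:M by exact: mulmx1C.
have ux'0 : (y - x') *m U^T != 0.
  apply: contra yx'0 => /eqP /(congr1 (fun v => v *m U)).
  by rewrite -mulmxA UTU mulmx1 mul0mx => ->.
have [t t0 Mb] := box_exit ux'0 (fun j => OmegaB j Kx').
exists x'; last first.
  have yx : enorm (y - x) < e / 2.
    rewrite /y addrAC subrr add0r enormZ gtr0_norm// /s mulrAC ltr_pdivrMr//.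
    by have := enorm_ge0 (x - c); nra.
  have yx' : enorm (y - x') < e / 2 by apply: le_lt_trans yx; exact: dx'.
  rewrite -(subrK y x) -addrA (le_lt_trans (ler_normD _ _))// distrC.
  by have := ler_norm_enorm (y - x); have := ler_norm_enorm (y - x'); lra.
(* Back in the original coordinates the displacement is [t *: (y - x')] with [t >= 0], so the
   nearest-point inequality carries over. *)
exists (x', x' *m U^T + t *: ((y - x') *m U^T)) => //; split; first by split.
move=> z Kz; rewrite /N /= mulmxDl -scalemxAl -!mulmxA UTU !mulmx1.
by rewrite addrAC subrr add0r dotZr mulr_ge0_le0// nx'.
Qed.

(* [x] goes to [g x] along an outer normal at [x]; by convexity this does not
   decrease distances. *)
Lemma hausdorff_boundary_le_box d :
  (hausdorff d (boundary Omega) <= hausdorff d (\bigcup_p face lo hi p))%E.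
Proof.
have /choice[g gP] : forall x, exists b, boundary Omega x ->
    (\bigcup_p face lo hi p) b /\
    forall z, closure Omega z -> dot (z - x) (b *m U - x) <= 0.
  move=> x; have [bx|nbx] := pselect (boundary Omega x); last by exists 0.
  by have [b] := boundary_normal bx; exists b.
apply: (hausdorff_isom d (f := g)) => [x /gP[]//|x y bx by_].
have [_ /(_ y (proj1 by_))] := gP x bx; have [_ /(_ x (proj1 bx))] := gP y by_.
move: (g x) (g y) => a b h1 h2.
apply: ler_enorm; rewrite -(dot_mulmx (a - b) (a - b) UU) mulmxBl.
(* The two normal inequalities say that the difference of the displacements has nonnegative product
   with [x - y], so adding it cannot shorten [x - y]. *)
have -> : a *m U - b *m U = (x - y) + ((a *m U - x) - (b *m U - y)).
  by apply/rowP => i; rewrite !mxE; ring.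
rewrite -opprB dotNl in h2.
move: h1 h2; move: (x - y) (a *m U - x) (b *m U - y) => v p q h1 h2.
have := dot_ge0 (p - q); rewrite !dot_lin (dotC p v) (dotC q v) (dotC q p); lra.
Qed.

End boundary_in_box.

(** * The greedy frame *)

Section greedy_frame.
Variables (R : realType) (n : nat).
Implicit Types (e p q : nat -> 'rV[R]_n) (d : nat -> R) (v : 'rV[R]_n).

Definition orthonormal_upto k e := forall i j, (i < k)%N -> (j < k)%N ->
  dot (e i) (e j) = (i == j)%:R.

(** The Gram-Schmidt remainder: the projection orthogonal to the first [k] vectors when these are
    orthonormal. *)
Definition reject e k v := v - \sum_(j < k) dot v (e j) *: e j.

Lemma dot_reject e k v j : orthonormal_upto k e -> (j < k)%N ->
  dot (reject e k v) (e j) = 0.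
Proof.
move=> oe jk; rewrite dotDl dotNl dot_suml (bigD1 (Ordinal jk))//= big1.
  by rewrite addr0 dotZl oe// eqxx mulr1 subrr.
by move=> i ij; rewrite dotZl oe// -(inj_eq val_inj) /= in ij *;
  rewrite (negbTE ij) mulr0.
Qed.

Lemma dot_reject_sq e k v : orthonormal_upto k e ->
  dot (reject e k v) (reject e k v) = dot v v - \sum_(j < k) dot v (e j) ^+ 2.
Proof.
move=> oe; rewrite {2}/reject dotDr dotNr [dot _ (\sum_(_ < _) _)]dotC dot_suml.
rewrite [X in _ - X]big1 ?subr0; last first.
  by move=> j _; rewrite dotZl [dot (e j) _]dotC dot_reject ?mulr0.
rewrite dotDl dotNl dot_suml; congr (_ - _); apply: eq_bigr => j _.
by rewrite dotZl [dot (e j) _]dotC expr2.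
Qed.

Lemma reject_continuous e k : continuous (reject e k).
Proof.
have cs : continuous (fun v : 'rV[R]_n => \sum_(j < k) dot v (e j) *: e j).
  apply: continuous_sum => i y.
  apply: (@continuousZr_tmp R 'rV[R]_n 'rV[R]_n (fun x => dot x (e i)) (e i) y).
  apply: (@dot_continuous R n _ id (fun=> e i)); last exact: cst_continuous.
  by move=> z; exact: cvg_id.
move=> x; exact: cvgB cvg_id (cs x).
Qed.

(** These are [k] homogeneous linear equations in more than [k] unknowns. *)
Lemma orthogonal_vector e k : (k < n)%N ->
  exists2 v, v != 0 & forall j, (j < k)%N -> dot v (e j) = 0.
Proof.
move=> kn; pose A := \matrix_(i < n, j < k) e j ord0 i.
have : kermx A != 0.
  rewrite -mxrank_eq0 mxrank_ker subn_eq0 -ltnNge.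
  exact: leq_ltn_trans (rank_leq_col A) kn.
move=> /rowV0Pn[v /sub_kermxP vA v0]; exists v => // j jk.
have := congr1 (fun M : 'rV_k => M ord0 (Ordinal jk)) vA; rewrite !mxE => <-.
by apply: eq_bigr => i _; rewrite mxE.
Qed.

Variable K : set 'rV[R]_n.
Hypotheses (cK : compact K) (iK : interior K !=set0).

(** The families are indexed by [nat] and constrained only below [k], so that the induction can
    extend them by changing the value at [k] alone. *)
Definition greedy_upto k e p q d := orthonormal_upto k e /\
  forall i, (i < k)%N -> [/\ K (p i) /\ K (q i), 0 < d i,
    reject e i (q i - p i) = d i *: e i &
    forall x y, K x -> K y -> enorm (reject e i (x - y)) <= d i].

(** Compactness gives a pair in [K] maximizing the length of the remainder. Interior points make the
    maximum positive, so the remainder can be normalized into the next vector. *)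
Lemma greedy_upto_exists k : (k <= n)%N -> exists e p q d, greedy_upto k e p q d.
Proof.
elim: k => [|k IH] kn.
  by exists (fun=> 0), (fun=> 0), (fun=> 0), (fun=> 0); split.
have [e [p [q [d [oe gr]]]]] := IH (ltnW kn).
have [c ic] := iK; have Kc := interior_subset ic.
pose f (u : 'rV[R]_n * 'rV[R]_n) :=
  dot (reject e k (u.2 - u.1)) (reject e k (u.2 - u.1)).
have cf : continuous f.
  suff h : continuous (fun u : 'rV[R]_n * 'rV[R]_n => reject e k (u.2 - u.1)).
    exact: dot_continuous.
  move=> u; apply: (@cvg_comp _ _ _ (fun u : 'rV[R]_n * 'rV[R]_n => u.2 - u.1)
    (reject e k) (nbhs u) (nbhs (u.2 - u.1))); last exact: reject_continuous.
  by apply: cvgB; [exact: cvg_snd|exact: cvg_fst].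
have [] := compact_EVT_max _ (compact_setX cK cK) (continuous_subspaceT cf).
  by exists (c, c).
move=> [a b]; rewrite inE => -[/= Ka Kb] fmax.
pose w := reject e k (b - a).
have wmax x y : K x -> K y -> enorm (reject e k (x - y)) <= enorm w.
  by move=> Kx Ky; apply: ler_enorm; apply: (fmax (y, x)); rewrite inE.
have w0 : 0 < enorm w.
  (* A vector orthogonal to the previous ones is its own remainder, and a short multiple of it added
     to [c] stays in [K]. *)
  have [v v0 ve] := orthogonal_vector e kn.
  have [r r0 rK] := (interiorP _ _).1 ic.
  have nv : 0 < `|v| by rewrite normr_gt0.
  have := wmax (c + (r / 2 / `|v|) *: v) c (rK _ _) Kc.
  rewrite addrAC subrr add0r opprD addrA subrr add0r normrN normrZ normrM normfV.
  rewrite normr_id divfK ?gt_eqF// gtr0_norm ?divr_gt0//.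
  move=> h; apply: lt_le_trans (h _); last by rewrite ltr_pdivrMr// ltr_pMr// ltr1n.
  rewrite /reject big1 ?subr0; last by move=> j _; rewrite dotZl ve// mulr0 scale0r.
  by apply: enorm_gt0; rewrite scaler_eq0 negb_or v0 gt_eqF ?divr_gt0.
pose e' i := if i == k then (enorm w)^-1 *: w else e i.
have e'E i : (i < k)%N -> e' i = e i by move=> ik; rewrite /e' ltn_eqF.
have e'k : e' k = (enorm w)^-1 *: w by rewrite /e' eqxx.
have rE i v : (i <= k)%N -> reject e' i v = reject e i v.
  move=> ik; congr (_ - _); apply: eq_bigr => j _.
  by rewrite e'E// (leq_trans _ ik).
exists e', (fun i => if i == k then a else p i), (fun i => if i == k then b else q i),
  (fun i => if i == k then enorm w else d i); split.
  have oek j : (j < k)%N -> dot (e' k) (e' j) = 0.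
    by move=> jk; rewrite e'k (e'E j)// dotZl dot_reject ?mulr0.
  move=> i j; rewrite ltnS leq_eqVlt => /predU1P[->|ik];
    rewrite ltnS leq_eqVlt => /predU1P[->|jk].
  - by rewrite e'k dotZl dotZr -sqr_enorm eqxx expr2 mulKf ?mulVf ?gt_eqF.
  - by rewrite oek// gtn_eqF.
  - by rewrite dotC oek// ltn_eqF.
  - by rewrite !e'E// oe.
move=> i; rewrite ltnS leq_eqVlt => /predU1P[->|ik].
  rewrite eqxx; split => //; first by rewrite rE// e'k scalerA divff ?scale1r// gt_eqF.
  by move=> x y Kx Ky; rewrite rE// wmax.
rewrite (ltn_eqF ik) e'E//; have [h1 h2 h3 h4] := gr _ ik; split => //.
  by rewrite rE ?h3// ltnW.
by move=> x y Kx Ky; rewrite rE ?h4// ltnW.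
Qed.

Lemma greedy_frame : exists (U : 'M[R]_n) (p q : 'I_n -> 'rV[R]_n) (d : 'I_n -> R),
  [/\ U *m U^T = 1%:M,
      forall i, [/\ K (p i), K (q i) & 0 < d i],
      forall i j : 'I_n, (i <= j)%N -> d j <= d i,
      forall i x y, K x -> K y -> `|dot (x - y) (row i U)| <= d i &
      forall i j : 'I_n, (i <= j)%N ->
        dot (q i - p i) (row j U) = if i == j then d i else 0].
Proof.
have [e [p [q [d [oe gr]]]]] := greedy_upto_exists (leqnn n).
exists (\matrix_i e i), p, q, d.
have rowE i : row i (\matrix_(i < n) e i) = e i by rewrite rowK.
have oei (i : 'I_n) : orthonormal_upto i e.
  by move=> j k ji ki; apply: oe; exact: ltn_trans (ltn_ord i).
split.
- apply/matrixP => i j; transitivity (dot (e i) (e j)); last by rewrite oe// mxE.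
  by rewrite mxE; apply: eq_bigr => k _; rewrite !mxE.
- by move=> i; have [[]] := gr _ (ltn_ord i).
- move=> i j ij; have [_ dj0 rj _] := gr _ (ltn_ord j).
  have [_ _ _] := gr _ (ltn_ord i).
  have [[Kp Kq] _ _ _] := gr _ (ltn_ord j) => /(_ _ _ Kq Kp); apply: le_trans.
  (* Rejecting only [i <= j] vectors leaves a remainder at least as long, and [d i] bounds all
     remainders at stage [i]. *)
  have -> : d j = enorm (reject e j (q j - p j)).
    rewrite rj enormZ gtr0_norm// enormE oe// eqxx sqrtr1 mulr1//.
  apply: ler_enorm; rewrite !dot_reject_sq// lerD2l lerN2.
  rewrite !(big_ord_widen n (fun k => dot (q j - p j) (e k) ^+ 2)) ?(ltnW (ltn_ord _))//.
  rewrite [leRHS](bigID (fun k : 'I_n => (k < i)%N))/=.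
  rewrite [X in _ <= X + _](eq_bigl (fun k : 'I_n => (k < i)%N)) ?lerDl.
    by apply: sumr_ge0 => *; exact: sqr_ge0.
  by move=> k /=; case: (ltnP k i) => ki; rewrite ?andbF// (leq_trans ki ij).
- move=> i x y Kx Ky; rewrite rowE; have [_ di0 _ /(_ _ _ Kx Ky)] := gr _ (ltn_ord i).
  apply: le_trans; rewrite enormE -sqrtr_sqr ler_wsqrtr// dot_reject_sq//.
  (* Bessel's inequality for one more vector: the component along [e i] is at most the length of the
     remainder at stage [i]. *)
  have oei1 : orthonormal_upto i.+1 e.
    by move=> j k ji ki; apply: oe; exact: leq_trans (ltn_ord i).
  have := dot_ge0 (reject e i.+1 (x - y)); rewrite dot_reject_sq//.
  by rewrite big_ord_recr /=; lra.
- move=> i j ij; rewrite rowE; have [_ _ ri _] := gr _ (ltn_ord i).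
  (* [q i - p i] lies in the span of the vectors up to [e i], with component [d i] on the last one;
     this is the triangularity. *)
  rewrite (_ : q i - p i = d i *: e i + \sum_(k < i) dot (q i - p i) (e k) *: e k).
    rewrite dotDl dotZl oe// dot_suml big1 ?addr0.
      by rewrite -val_eqE; case: eqP; rewrite ?mulr1 ?mulr0.
    move=> k _; rewrite dotZl oe ?(ltn_trans (ltn_ord k))//.
    by rewrite ltn_eqF ?mulr0// (leq_trans (ltn_ord k)).
  by rewrite -ri subrK.
Qed.

End greedy_frame.

(** * The perimeter is bounded by a section *)

Section zonotope_section.
Variables (R : realType) (m : nat).
Let n := m.+2.
Variables (Omega : set 'rV[R]_n) (U : 'M[R]_n) (p q : 'I_n -> 'rV[R]_n)
  (d : 'I_n -> R).
Hypotheses (cOmega : convex_prop Omega) (iOmega : interior Omega !=set0)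
  (UU : U *m U^T = 1%:M)
  (Kpq : forall i, [/\ closure Omega (p i), closure Omega (q i) & 0 < d i])
  (Uwidth : forall i x y, closure Omega x -> closure Omega y ->
    `|dot (x - y) (row i U)| <= d i)
  (Upq : forall i j : 'I_n, (i <= j)%N ->
    dot (q i - p i) (row j U) = if i == j then d i else 0).

Let w (i : 'I_m.+1) : 'I_n := widen_ord (leqnSn m.+1) i.
(** All frame vectors but the last; they span the direction of the hyperplane. *)
Let E : 'M[R]_(m.+1, n) := \matrix_(i < m.+1) row (w i) U.
(** Dividing by [d (w j)] makes the parallelepiped unitriangular in units of [d (w j) / n]. The
    width bound gives entries of absolute value at most 1. *)
Let a (i j : 'I_m.+1) : R := dot (q (w i) - p (w i)) (row (w j) U) / d (w j).
(* The parallelepiped of the points [(c + x_1 + ... + x_(n-1)) / n], with [x_i] in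
   the segment [p_i, q_i], in coordinates along the frame. *)
Let A : set 'rV[R]_m.+1 := [set y | exists2 s : 'I_m.+1 -> R,
  forall j, 0 <= s j <= 1 &
  forall j, y ord0 j = d (w j) / n%:R *
                       (s j + \sum_(i < m.+1 | (j < i)%N) s i * a i j)].

Let d0 i : 0 < d i. Proof. by have [] := Kpq i. Qed.

Let row_row i j : dot (row i U) (row j U) = (i == j)%:R.
Proof.
have := congr1 (fun M : 'M[R]_n => M i j) UU; rewrite !mxE => <-.
by apply: eq_bigr => k _; rewrite !mxE.
Qed.

Let EE : E *m E^T = 1%:M.
Proof.
apply/matrixP => i j; transitivity (dot (row (w i) U) (row (w j) U)).
  by rewrite mxE; apply: eq_bigr => k _; rewrite !mxE.
by rewrite row_row mxE.
Qed.

Let rank_E : \rank E = m.+1.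
Proof. by apply/eqP/row_freeP; exists E^T. Qed.

Let box_le_A : (hausdorff m.+1 (box (fun j => d (w j) / n%:R)%R) <= hausdorff m.+1 A)%E.
Proof.
(* Take [C = n]: a coordinate, in units of the side, is [s j <= 1] plus at most [n - 1] terms of
   size at most 1. *)
apply: (@hausdorff_box_le_tile _ _ _ _ m.+2) => [j|y j [s s01 ->]|x].
- by rewrite divr_gt0.
- rewrite normrM gtr0_norm ?divr_gt0// mulrC ler_pM2r ?divr_gt0//.
  apply: le_trans (ler_normD _ _) _; rewrite -[m.+2%:R]natr1 addrC lerD//.
    apply: le_trans (ler_norm_sum _ _ _) _.
    apply: (@le_trans _ _ (\sum_(i < m.+1 | (j < i)%N) (1 : R))).
      apply: ler_sum => i _; rewrite normrM.
      have /andP[s0 s1] := s01 i; rewrite (ger0_norm s0) mulr_ile1//.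
      rewrite normrM normfV (gtr0_norm (d0 _)) ler_pdivrMr// mul1r.
      by have [Kp Kq _] := Kpq (w i); exact: Uwidth.
    rewrite sumr_const ler_nat; apply: leq_trans (max_card _) _.
    by rewrite card_ord.
  by have /andP[s0 s1] := s01 j; rewrite ger0_norm.
- have [s [k [s01 sk]]] := triangular_tiling a (fun j => x ord0 j / (d (w j) / n%:R)).
  exists k; exists s => // j; rewrite !mxE.
  have l0 : d (w j) / n%:R != 0 by rewrite gt_eqF ?divr_gt0.
  have /(congr1 (fun r => r * (d (w j) / n%:R))) := sk j; rewrite divfK// => ->.
  by ring.
Qed.

(** The point is the mean of [c] and [n - 1] points of the segments from [p_i] to [q_i]. These lie
    only in the closure, but the weight of the interior point [c] brings the mean into [Omega]. *)
Let zonotope_in_Omega c (s : 'I_m.+1 -> R) : interior Omega c ->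
  (forall j, 0 <= s j <= 1) ->
  Omega (n%:R^-1 *: (c + \sum_(i < m.+1) p (w i)) +
         n%:R^-1 *: \sum_(i < m.+1) s i *: (q (w i) - p (w i))).
Proof.
move=> ic s01.
pose x (i : 'I_m.+1) := (1 - s i) *: p (w i) + s i *: q (w i).
have Kx : closure Omega (m.+1%:R^-1 *: \sum_(i < m.+1) x i).
  have := @convex_average _ _ _ (fun i => x (inord i)) m (convex_closure cOmega).
  rewrite (eq_bigr x) => [|i _]; last by rewrite inord_val.
  apply => i im; have [Kp Kq _] := Kpq (w (inord i)).
  exact: (convex_closure cOmega).
have n01 : 0 < (n%:R^-1 : R) <= 1.
  by rewrite invr_gt0 ltr0n invf_le1 ?ler1n.
have := convex_closure_interior cOmega ic Kx n01; congr Omega.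
rewrite scalerA addrC -!scalerDr -addrA -big_split /=.
rewrite (_ : (1 - _) * _ = n%:R^-1); last first.
  rewrite /n -[m.+2%:R]natr1; have m1 : m.+1%:R + 1 != 0 :> R by rewrite natr1 pnatr_eq0.
  have m0 : m.+1%:R != 0 :> R by rewrite pnatr_eq0.
  by move: m.+1%:R m0 m1 => b b0 b1; field; rewrite b0 b1.
rewrite -scalerDr; congr (_ *: (_ + _)); apply: eq_bigr => i _.
by rewrite /x scalerBl scale1r scalerBr addrAC addrA.
Qed.

Let Upq0 (i j : 'I_n) : (i < j)%N -> dot (q i - p i) (row j U) = 0.
Proof. by move=> ij; rewrite Upq ?(ltnW ij)//; case: eqP ij => // ->; rewrite ltnn. Qed.

Let vector_coord (v : 'rV[R]_n) : v = \sum_(j < n) dot v (row j U) *: row j U.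
Proof.
rewrite -[LHS]mulmx1 -(mulmx1C UU) mulmxA mulmx_sum_row.
apply: eq_bigr => j _; congr (_ *: _); rewrite mxE.
by apply: eq_bigr => i _; rewrite !mxE.
Qed.

Let A_le_section : exists2 V, affine_subspace m.+1 V &
  (hausdorff m.+1 A <= hausdorff m.+1 (Omega `&` V))%E.
Proof.
have [c ic] := iOmega.
pose z0 := n%:R^-1 *: (c + \sum_(i < m.+1) p (w i)).
(* [<<E>>] is a square matrix with the row space of [E], as [affine_subspace] requires. *)
exists [set x | (x - z0 <= <<E>>)%MS].
  by exists z0, <<E>>%MS; rewrite genmxE rank_E.
apply: (hausdorff_isom m.+1 (f := fun y => z0 + y *m E)); last first.
  move=> x y _ _; rewrite opprD addrACA subrr add0r -mulmxBl.
  by apply: ler_enorm; rewrite dot_mulmx.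
move=> y [s s01 ys]; split; last first.
  by rewrite /= addrC addKr genmxE submxMl.
have := zonotope_in_Omega ic s01; congr (Omega (_ + _)).
set v := _ *: \sum_(_ < _) _.
have vE j : dot v (row j U) = n%:R^-1 *
    \sum_(i < m.+1) s i * dot (q (w i) - p (w i)) (row j U).
  by rewrite dotZl dot_suml; congr (_ * _); apply: eq_bigr => i _; rewrite dotZl.
(* By triangularity the edges have no component along the last frame vector: this puts the
   parallelepiped in a hyperplane. *)
rewrite (vector_coord v) big_ord_recr /= [X in _ + X](_ : _ = 0) ?addr0; last first.
  rewrite vE big1 ?mulr0 ?scale0r// => i _.
  by rewrite (@Upq0 (w i) ord_max (ltn_ord i)) mulr0.
rewrite mulmx_sum_row; apply: eq_bigr => j _; rewrite rowK; congr (_ *: _).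
rewrite -/(w j) vE ys mulrAC mulrC; congr (_ * _).
rewrite mulrDr mulr_sumr (bigD1 j)//= Upq// eqxx mulrC; congr (_ + _).
rewrite [LHS]big_mkcond [RHS]big_mkcond; apply: eq_bigr => i _ /=.
rewrite -val_eqE /=; case: (ltngtP i j) => //= [ij|ji].
  by rewrite Upq0 ?mulr0.
by rewrite /a mulrCA [d _ * _]mulrC divfK// gt_eqF.
Qed.

Lemma hausdorff_box_le_section :
  (hausdorff m.+1 (box (fun j => d (w j))) <=
     (n%:R ^+ m.+1)%:E * max_section Omega)%E.
Proof.
(* Shrinking by [n] carries the box with sides [d] into the one with sides [d / n]. *)
apply: (@le_trans _ _ ((n%:R ^+ m.+1)%:E *
    hausdorff m.+1 (box (fun j => d (w j) / n%:R)%R))%E).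
  apply: (hausdorff_expand1 m.+1 (f := fun x => n%:R^-1 *: x)) => //.
    move=> x xd j; rewrite mxE mulrC ler_pM2r ?invr_gt0//.
    by have := xd j; rewrite -[0 <= _]/(0 <= _) pmulr_lge0 ?invr_gt0.
  move=> x y _ _; rewrite -scalerBr enormZ ger0_norm ?invr_ge0//.
  by rewrite mulVKf ?pnatr_eq0.
apply: lee_wpmul2l; first by rewrite lee_fin exprn_ge0.
apply: (le_trans box_le_A); have [V affV AV] := A_le_section.
apply: (le_trans AV); apply: ereal_sup_ubound; exists V => //.
Qed.

End zonotope_section.

Section perimeter_le_section.
Variables (R : realType).

(** Deleting the fixed coordinate and shifting preserves distances. As the sides decrease, the
    [j]-th remaining side is at most [d j], whichever one was deleted. *)
Lemma hausdorff_face_le_box m (lo d : 'I_m.+1 -> R) pr :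
  (forall i j : 'I_m.+1, (i <= j)%N -> d j <= d i) ->
  (hausdorff m (face lo (fun j => lo j + d j)%R pr) <=
   hausdorff m (box (fun j => d (widen_ord (leqnSn m) j))))%E.
Proof.
move=> dle; case: pr => i b.
apply: (hausdorff_isom m (f := fun v : 'rV[R]_m.+1 =>
    \row_j (v ord0 (lift i j) - lo (lift i j)))).
  move=> v vf j; rewrite mxE.
  have := vf (lift i j); rewrite /= eq_sym (negbTE (neq_lift _ _)).
  have : d (lift i j) <= d (widen_ord (leqnSn m) j).
    by apply: dle; rewrite /= /bump leq_addl.
  by lra.
move=> x y xf yf; apply: ler_enorm; rewrite {1}/dot (bigD1_ord i)//=.
have := xf i; have := yf i; rewrite /= eqxx !mxE => -> ->.
rewrite subrr mul0r add0r le_eqVlt; apply/orP; left; apply/eqP.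
by apply: eq_bigr => j _; rewrite !mxE; ring.
Qed.

Lemma perimeter_le_section m (Omega : set 'rV[R]_m.+2) : convex_body Omega ->
  (hausdorff m.+1 (boundary Omega) <=
   (2 * m.+2%:R ^+ m.+2)%:E * max_section Omega)%E.
Proof.
move=> [bO /convex_set_prop cO iO].
have cK := compact_closure bO.
have iK : interior (closure Omega) !=set0.
  by have [c ic] := iO; exists c; apply: interiorS ic; exact: subset_closure.
have [U [p [q [d [UU Kpq dle Uw Upq]]]]] := greedy_frame cK iK.
(* The width in direction [i] is attained by [p i] and [q i], so they mark the two ends of the
   box. *)
pose lo i := dot (p i) (row i U).
have rowE (x : 'rV[R]_m.+2) j : (x *m U^T) ord0 j = dot x (row j U).
  by rewrite mxE; apply: eq_bigr => k _; rewrite !mxE.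
have OB x j : closure Omega x -> lo j <= (x *m U^T) ord0 j <= lo j + d j.
  move=> Kx; rewrite rowE; have [Kp Kq _] := Kpq j.
  have := Uw j _ _ Kx Kp; have := Uw j _ _ Kq Kx; have := Upq j j (leqnn _).
  by rewrite eqxx !ler_norml !dotDl !dotNl /lo; lra.
apply: le_trans (hausdorff_boundary_le_box bO cO iO UU OB _) _.
have bF (pr : 'I_m.+2 * bool) : (hausdorff m.+1 (face lo (fun j => lo j + d j)%R pr) <=
    (m.+2%:R ^+ m.+1)%:E * max_section Omega)%E.
  apply: le_trans (hausdorff_face_le_box _ _ dle) _.
  exact: (hausdorff_box_le_section cO iO UU Kpq Uw Upq).
apply: le_trans (outer_measure_le_card bF) _.
rewrite card_prod card_ord card_bool muleA -EFinM natrM.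
by rewrite [in leRHS]exprS mulrA [2 * _]mulrC.
Qed.

(** For the degenerate case of a division by [ball_volume]: small sets then have gauge 0, and
    countably many small cubes cover the space. *)
Lemma hausdorff_eq0 n d (A : set 'rV[R]_n) :
  ball_volume R d = 0 -> hausdorff d A = 0%E.
Proof.
move=> b0; apply/eqP; rewrite eq_le outer_measure_ge0 andbT.
apply: ge_ereal_sup => _ [delta delta0 <-].
pose eps := delta / n.+1%:R.
have eps0 : 0 < eps by rewrite divr_gt0.
pose cell (K : 'rV[int]_n) : set 'rV[R]_n := [set x | forall i,
  (K ord0 i)%:~R * eps <= x ord0 i <= (K ord0 i + 1)%:~R * eps].
(* The grid cells are enumerated by coding integer vectors; numbers that code nothing give the empty
   set. *)
pose F k := oapp cell set0 (unpickle k).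
have F0 k : hausdorff_gauge d delta (F k) = 0%E.
  rewrite /hausdorff_gauge; case: ifPn => // Fk; rewrite ifT.
    by rewrite b0 mul0r mul0e.
  apply: ge_ereal_sup => _ [x Fx [y Fy <-]].
  rewrite lee_fin enormE -(gtr0_norm delta0) -sqrtr_sqr ler_wsqrtr//.
  apply: (@le_trans _ _ (\sum_(i < n) eps ^+ 2)).
    apply: ler_sum => i _; rewrite !mxE -expr2 -[leLHS]real_normK ?num_real//.
    rewrite lerXn2r ?nnegrE ?(ltW eps0)//.
    move: Fx Fy; rewrite /F; case: unpickle => //= K /(_ i) Kx /(_ i).
    by move: Kx; rewrite intrD ler_norml; lra.
  rewrite sumr_const card_ord -[eps ^+ 2 *+ n]mulr_natl.
  rewrite (_ : delta = n.+1%:R * eps); last by rewrite mulrC divfK.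
  rewrite [leRHS]exprMn ler_wpM2r ?sqr_ge0// expr2 -natrM ler_nat; lia.
apply: (@le_trans _ _ (\sum_(k <oo) hausdorff_gauge d delta (F k))%E).
  apply: ereal_inf_lbound; exists F => // x _.
  exists (pickle (\row_i Num.floor (x ord0 i / eps) : 'rV[int]_n)) => //.
  rewrite /F pickleK /= => i; rewrite mxE; apply/andP; split.
    by rewrite -ler_pdivlMr// Num.Theory.floor_le.
  by rewrite -ler_pdivrMr// ltW// floorD1_gt.
by rewrite eseries0.
Qed.

End perimeter_le_section.

(** * A section is bounded by the perimeter *)

Section section_le_perimeter.
Variable R : realType.

(** The exit time is the supremum of the times spent in [Omega]: its point is a limit of points of
    [Omega], and were it interior, a later time would do. *)
Lemma ray_exit n (Omega : set 'rV[R]_n) x u : open Omega -> bounded_set Omega ->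
  Omega x -> u != 0 -> exists2 s : R, 0 <= s & boundary Omega (x + s *: u).
Proof.
move=> oO [M [_ bM]] Ox u0.
have nu : 0 < `|u| by rewrite normr_gt0.
pose A := [set s : R | 0 <= s /\ Omega (x + s *: u)].
have A0 : A 0 by split => //; rewrite scale0r addr0.
have supA : has_sup A.
  split; first by exists 0.
  exists ((M + 1 + `|x|) / `|u|) => s [s0 Os]; rewrite ler_pdivlMr//.
  rewrite -{1}(ger0_norm s0) -normrZ.
  have M1 : M < M + 1 by rewrite ltrDl.
  have h : `|x + s *: u| <= M + 1 := bM _ M1 _ Os.
  have := ler_normB (x + s *: u) x; rewrite [x + _ - x]addrAC subrr add0r.
  by move=> /le_trans; apply; rewrite lerD2r.
exists (sup A); first exact: sup_upper_bound.
split.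
  apply/closureP => e e0.
  have e1 : 0 < e / `|u| by rewrite divr_gt0.
  have [s [s0 Os] ls] := sup_adherent e1 supA; exists (x + s *: u) => //.
  rewrite opprD addrACA subrr add0r -scalerBl normrZ -ltr_pdivlMr//.
  have : s <= sup A by apply: sup_upper_bound.
  by rewrite ltr_norml; lra.
move=> /interiorP[e e0 eO].
have e1 : 0 < e / 2 / `|u| by rewrite !divr_gt0.
have : A (sup A + e / 2 / `|u|).
  split; first exact: addr_ge0 (sup_upper_bound supA A0) (ltW e1).
  apply: eO; rewrite scalerDl addrA opprD addrA subrr add0r normrN normrZ.
  by rewrite gtr0_norm// divfK ?gt_eqF// ltr_pdivrMr// ltr_pMr// ltr1n.
by move=> /(sup_upper_bound supA); rewrite gerDl leNgt e1.
Qed.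

Lemma hyperplane_normal m (V : set 'rV[R]_m.+1) : affine_subspace m V ->
  exists2 nu : 'rV[R]_m.+1, dot nu nu = 1 &
    forall x y, V x -> V y -> dot (x - y) nu = 0.
Proof.
move=> [p [W [rW ->]]].
have : kermx W^T != 0.
  by rewrite -mxrank_eq0 mxrank_ker mxrank_tr rW subSnn.
move=> /rowV0Pn[v /sub_kermxP vW v0].
have ev := enorm_gt0 v0.
exists ((enorm v)^-1 *: v) => [|x y /= xV yV].
  by rewrite dotZl dotZr -sqr_enorm expr2 mulKf ?mulVf ?gt_eqF.
have /submxP[D xyD] : (x - y <= W)%MS.
  have -> : x - y = (x - p) + -1 *: (y - p) by rewrite scaleN1r opprB addrA subrK.
  by rewrite addmx_sub// scalemx_sub.
rewrite dotZr dotC xyD dotE trmx_mul mulmxA vW mul0mx mxE mulr0//.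
Qed.

(* Push the slightly contracted section to the boundary along both normals. *)
Lemma section_le_perimeter m (Omega : set 'rV[R]_m.+1) :
  bounded_convex_domain Omega ->
  (2%:E * max_section Omega <= hausdorff m (boundary Omega))%E.
Proof.
move=> [oO _ bO /convex_set_prop cO].
rewrite -lee_pdivlMl//; apply: ge_ereal_sup => _ [V affV <-].
rewrite lee_pdivlMl//=; set S := Omega `&` V.
have [S0|/set0P[p [Op Vp]]] := eqVneq S set0.
  by rewrite S0 outer_measure0 mule0 outer_measure_ge0.
have [nu nu1 Vnu] := hyperplane_normal affV.
have nu0 : nu != 0.
  by apply/eqP => nu0; move: nu1; rewrite nu0 dot0l => /eqP; rewrite eq_sym oner_eq0.
have iO : Omega `<=` interior Omega by move: oO; rewrite openE.
have [r r0 rO] := (interiorP _ _).1 (iO _ Op).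
(* The section is contracted towards [p] by the factor [L^-1], at a cost of [L ^+ m] that vanishes
   as [L] tends to 1. *)
apply: (@lee_of_le_expr_mul _ m); first exact: outer_measure_ge0.
move=> L L1; have L0 : 0 < L by lra.
pose t := 1 - L^-1.
have Lt : 1 - t = L^-1 by rewrite /t subKr.
have LV1 : L^-1 < 1 by rewrite invf_lt1.
have LV0 : 0 < L^-1 by rewrite invr_gt0.
have t0 : 0 < t by rewrite subr_gt0.
have t1 : t <= 1 by rewrite /t; lra.
pose y x := (1 - t) *: x + t *: p.
(* Contracted points stay at distance at least [t * r] from the complement, so both exit times are
   at least [t * r]. *)
have yO x z : Omega x -> `|y x - z| < t * r -> Omega z.
  move=> Ox yz; have -> : z = (1 - t) *: x + t *: (p + t^-1 *: (z - y x)).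
    by rewrite scalerDr scalerA mulfV ?gt_eqF// scale1r addrA addrC subrK.
  apply: cO => //; last by rewrite ltW.
  apply: rO; rewrite opprD addrA subrr add0r normrN normrZ distrC.
  by rewrite gtr0_norm ?invr_gt0// mulrC ltr_pdivrMr// mulrC.
have nnu : `|nu| <= 1.
  by apply: le_trans (ler_norm_enorm _) _; rewrite enormE nu1 sqrtr1.
have exit (i : 'I_2) x : exists s : R, S x ->
    t * r <= s /\ boundary Omega (y x + s *: ((-1) ^+ i *: nu)).
  have [[Ox _]|nSx] := pselect (S x); last by exists 0.
  have u0 : (-1) ^+ i *: nu != 0 by rewrite scaler_eq0 signr_eq0.
  have Oy : Omega (y x) by apply: (yO x) => //; rewrite subrr normr0 mulr_gt0.
  have [s s0 bs] := ray_exit oO bO Oy u0.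
  exists s => _; split => //; rewrite leNgt; apply/negP => st.
  case: bs => _; apply; apply: iO.
  apply: (yO x) => //; rewrite opprD addrA subrr add0r normrN !normrZ.
  rewrite normr_sign mul1r (ger0_norm s0).
  by apply: le_lt_trans st; rewrite ler_piMr.
have /choice[s0 s0P] := exit ord0; have /choice[s1 s1P] := exit ord_max.
pose s (i : 'I_2) := if i == ord0 then s0 else s1.
have sP i x : S x ->
    t * r <= s i x /\ boundary Omega (y x + s i x *: ((-1) ^+ i *: nu)).
  rewrite /s; case: eqP => [->|]; first exact: s0P.
  case: i => -[|[|]]// i i0; first by case: i0; exact: val_inj.
  by move=> Sx; have := s1P x Sx.
pose f i x := y x + s i x *: ((-1) ^+ i *: nu).
have fB i j x z : f i x - f j z =
    L^-1 *: (x - z) + ((-1) ^+ i * s i x - (-1) ^+ j * s j z) *: nu.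
  rewrite /f /y Lt !scalerA; apply/rowP => k; rewrite !mxE; ring.
have pyth (v : 'rV[R]_m.+1) (a c : R) : dot v nu = 0 ->
    dot (a *: v + c *: nu) (a *: v + c *: nu) = a ^+ 2 * dot v v + c ^+ 2.
  by move=> vnu; rewrite !dot_lin (dotC nu v) vnu nu1; ring.
have fdot i j x z : S x -> S z -> dot (f i x - f j z) (f i x - f j z) =
    L^-1 ^+ 2 * dot (x - z) (x - z) + ((-1) ^+ i * s i x - (-1) ^+ j * s j z) ^+ 2.
  by move=> [_ Vx] [_ Vz]; rewrite fB pyth// Vnu.
apply: (hausdorff_expand m (f := f) (eta := t * r)) => //.
- exact: mulr_gt0.
- by move=> i x Sx; exact: (sP i x Sx).2.
- move=> i x z Sx Sz; rewrite -(gtr0_norm L0) -enormZ; apply: ler_enorm.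
  rewrite dotZl dotZr fdot//.
  rewrite [leLHS](_ : _ = L * (L * (L^-1 ^+ 2 * dot (x - z) (x - z)))); last first.
    by rewrite expr2 -!mulrA !mulVKf ?gt_eqF.
  by rewrite !ler_pM2l// lerDl sqr_ge0.
move=> i j x z ij Sx Sz.
have [tx _] := sP i x Sx; have [tz _] := sP j z Sz.
have tr0 : 0 < t * r by exact: mulr_gt0.
rewrite enormE -(gtr0_norm tr0) -sqrtr_sqr ler_wsqrtr// fdot//.
(* Distinct indices mean opposite normals: the exit times add up and separate the two images. *)
have -> : (-1) ^+ j = - (-1) ^+ i :> R.
  by case: i j ij {Sx Sz tx tz} => -[|[|]]// ? [[|[|]]]// ? _ /=;
    rewrite ?expr0 ?expr1 ?opprK.
rewrite mulNr opprK -mulrDr [X in _ <= _ + X]exprMn sqrr_sign mul1r.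
have := dot_ge0 (x - z); have := sqr_ge0 (L^-1 : R) => h1 h2.
have := mulr_ge0 h1 h2.
have : (t * r) ^+ 2 <= (s i x + s j z) ^+ 2.
  by rewrite lerXn2r ?nnegrE ?(ltW tr0)//; lra.
lra.
Qed.

End section_le_perimeter.

(** * From the two comparisons to the bounds *)

Section bounds.
Variable R : realType.
Local Open Scope ereal_scope.

Lemma lee_expe (x y : \bar R) n : 0 <= x -> x <= y -> x ^+ n <= y ^+ n.
Proof.
by move=> x0 xy; elim: n => // n IH; rewrite !expeS lee_pmul// expe_ge0.
Qed.

Lemma expeZ (r : R) (x : \bar R) n : (r%:E * x) ^+ n = (r ^+ n)%:E * x ^+ n.
Proof.
elim: n => [|n IH]; first by rewrite !expe0 mule1.
by rewrite !expeS IH exprS EFinM muleACA.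
Qed.

Lemma bounded_convex_domain_body n (Omega : set 'rV[R]_n) :
  bounded_convex_domain Omega -> convex_body Omega.
Proof.
move=> [oO [c Oc] bO cO]; split => //; exists c.
by move: oO; rewrite openE; apply.
Qed.

(** Nonnegativity is inherited from the perimeter, which avoids exhibiting a hyperplane for the
    supremum. *)
Lemma max_section_ge0 m (Omega : set 'rV[R]_m.+2) : convex_body Omega ->
  0 <= max_section Omega.
Proof.
move=> /perimeter_le_section /(le_trans (outer_measure_ge0 _ _)).
by rewrite pmule_rge0// lte_fin mulr_gt0// exprn_gt0.
Qed.

Lemma perimeter_le_max_section n (Omega : set 'rV[R]_n) : (2 <= n)%N ->
  convex_body Omega -> hausdorff n.-1 (boundary Omega)
    <= ((2 * n)%:R ^+ n / ball_volume R n.-1)%:E * max_section Omega.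
Proof.
case: n Omega => [|[|m]] Omega // _ cO.
(* Division by zero yields 0, so in this case the perimeter itself has to vanish. *)
have [b0|b0] := eqVneq (ball_volume R m.+1) 0%R.
  by rewrite (hausdorff_eq0 _ b0) b0 invr0 mulr0 mul0e.
have bgt0 : (0 < ball_volume R m.+1)%R by rewrite lt_neqAle eq_sym b0 ball_volume_ge0.
apply: le_trans (perimeter_le_section cO) _.
apply: lee_wpmul2r; first exact: max_section_ge0.
rewrite lee_fin ler_pdivlMr// natrM exprMn [X in (_ <= X * _)%R]exprS.
have P0 : (0 <= m.+2%:R ^+ m.+2 :> R)%R by exact: exprn_ge0.
(* The constant becomes [2 * n ^ n * 2 ^ (n - 1) = (2 * n) ^ n]. *)
have := ler_wpM2l P0 (ball_volume_le R m.+1).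
by move: (_ ^+ _)%R (_ ^+ _)%R => P Q; lra.
Qed.

(** Both comparisons of perimeter and section are raised to the power [n]; the inverse power of the
    volume is a common nonnegative factor. *)
Lemma perimeter_section_bounds n (C1 C2 : R) : (2 <= n)%N ->
  (0 <= C1)%R -> (0 <= C2)%R -> perimeter_bounds n C1 C2 -> section_bounds n C1 C2.
Proof.
move=> n2 C10 C20 pb Omega dO; have cO := bounded_convex_domain_body dO.
have /andP[lo hi] := pb _ dO; have hi2 := perimeter_le_max_section n2 cO.
case: n n2 => [|[|m]]// _ in Omega pb dO cO lo hi hi2 *.
have lo2 := section_le_perimeter dO; have A0 := max_section_ge0 cO.
have X0 : 0 <= (hausdorff m.+2 Omega ^+ m.+1)^-1.
  by rewrite inve_ge0 expe_ge0// outer_measure_ge0.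
apply/andP; split.
  apply: le_trans lo.
  rewrite (mulrC _ C1) EFinM -(muleA C1%:E).
  apply: lee_wpmul2l; first by rewrite lee_fin.
  rewrite muleA -expeZ; apply: lee_wpmul2r => //.
  by apply: lee_expe; rewrite ?mule_ge0.
apply: (le_trans hi).
rewrite (mulrC _ C2) EFinM -(muleA C2%:E).
apply: lee_wpmul2l; first by rewrite lee_fin.
rewrite muleA -exprVn -mulnn exprM -exprMn -expeZ; apply: lee_wpmul2r => //.
by apply: lee_expe; rewrite ?outer_measure_ge0.
Qed.

End bounds.

Theorem lemma2p4 (R : realType) :
  (forall (n : nat) (Omega : set 'rV[R]_n), (2 <= n)%N -> convex_body Omega ->
     (hausdorff n.-1 (boundary Omega)
        <= ((2 * n)%:R ^+ n / ball_volume R n.-1)%:E * max_section Omega)%E)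
  /\ (statement_T R -> statement_C R).
Proof.
split=> [n Omega|T n n2]; first exact: perimeter_le_max_section.
split=> [C1 C2 C10 C20|]; first by apply: perimeter_section_bounds; rewrite ?ltW.
apply: perimeter_section_bounds => //; last by have [_] := T n n2.
  rewrite /explicit_C1 mulr_ge0 ?powR_ge0//.
  by apply: mulr_ge0; [exact: ball_volume_ge0|rewrite invr_ge0 exprn_ge0].
by rewrite /explicit_C2 mulr_ge0 ?powR_ge0// exprn_ge0.
Qed.
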